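(* Consider the generalized linear model (GLM) with losses $f_t$ ($t=1,\ldots,T$) described in the context and logistic activation function $\sigma(z)=(1+e^{-z})^{-1}$. Assume that $\|\bm{x}\|\le1$ holds almost surely over $\bm{x}\sim\mathcal{P}$ and that $\bm{w}_t^\star\in\mathcal{W}_t$ for some closed convex set $\mathcal{W}_t$ with $\mathrm{diam}(\mathcal{W}_t)=R$. Then the GLM with logistic activation function is $\rho$-quasar-convex with respect to $\bm{w}_t^\star$ with $\rho=2e^{-R}$, $\Gamma$-weakly smooth with $\Gamma=\frac18$, and $K$-Lipschitz continuous with $K=\frac14$. Hence, using the step size $0<\alpha_t=\alpha<32e^{-R}$, the regret of online projected gradient descent is upper bounded by $$\mathrm{Regret}(T)\le\frac{8}{32\alpha e^{-R}-\alpha^2}\|\bm{w}_1-\bm{w}_1^\star\|^2+\frac{24R}{32\alpha e^{-R}-\alpha^2}\sum_{t=1}^{T-1}\|\bm{w}_t^\star-\bm{w}_{t+1}^\star\|+\frac{8\alpha}{32e^{-R}-\alpha}\sum_{t=1}^{T-1}\delta_t^2.$$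
   Context: Setup. $\|\cdot\|$ is the Euclidean norm. $\mathcal{P}$ is a probability distribution on $\mathbb{R}^n$, absolutely continuous with respect to the $n$-dimensional Lebesgue measure; write $\sigma\langle\bm{w},\bm{x}\rangle=\sigma(\langle\bm{w},\bm{x}\rangle)$. For underlying parameters $\bm{w}_1^\star,\ldots,\bm{w}_T^\star\in\mathbb{R}^n$, the GLM at time $t$ is the problem of minimizing over $\bm{w}\in\mathbb{R}^n$ the loss $f_t(\bm{w})=\mathbb{E}_{\bm{x}\sim\mathcal{P}}\left[\tfrac12(\sigma\langle\bm{w},\bm{x}\rangle-\sigma\langle\bm{w}_t^\star,\bm{x}\rangle)^2\right]$, so $\bm{w}_t^\star$ is a minimizer of $f_t$. $\mathrm{diam}(\mathcal{W})=\max_{\bm{w},\bm{w}'\in\mathcal{W}}\|\bm{w}-\bm{w}'\|$. Definitions. For $\rho\in(0,1]$, a differentiable $f\colon\mathbb{R}^n\to\mathbb{R}$ with minimizer $\bm{w}^\star$ is $\rho$-quasar-convex with respect to $\bm{w}^\star$ if $f(\bm{w}^\star)\ge f(\bm{w})+\frac1\rho\langle\nabla f(\bm{w}),\bm{w}^\star-\bm{w}\rangle$ for all $\bm{w}\in\mathbb{R}^n$. A differentiable $f$ is $\Gamma$-weakly smooth if $\|\nabla f(\bm{w})\|^2\le\Gamma(f(\bm{w})-f(\bm{w}^\star))$ for all $\bm{w}\in\mathbb{R}^n$, where $\bm{w}^\star$ is a minimizer of $f$ over $\mathbb{R}^n$. Online projected gradient descent: given $\bm{w}_1\in\mathcal{W}_1$,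 at each $t$ collect $m$ i.i.d. samples $\bm{x}^{i,t}\sim\mathcal{P}$ with labels $y_t^i=\sigma\langle\bm{w}_t^\star,\bm{x}^{i,t}\rangle$, $i=1,\ldots,m$, and set $\bm{w}_{t+1}=\mathrm{proj}_{\mathcal{W}_{t+1}}(\bm{w}_t-\alpha_t\tilde\nabla f_t(\bm{w}_t))$ (Euclidean projection), where $\tilde\nabla f_t(\bm{w}_t)=\frac1m\sum_{i=1}^m(\sigma\langle\bm{w}_t,\bm{x}^{i,t}\rangle-y_t^i)\,\sigma'(\langle\bm{w}_t,\bm{x}^{i,t}\rangle)\,\bm{x}^{i,t}$. Writing $\tilde\nabla f_t(\bm{w}_t)=\nabla f_t(\bm{w}_t)+\bm{e}_t$, the gradient error satisfies $\mathbb{E}[\bm{e}_t]=\bm{0}$ and $\mathbb{E}[\|\bm{e}_t\|^2]\le\delta_t^2$ for a constant $\delta_t>0$. $\mathrm{Regret}(T)=\sum_{t=1}^T(\mathbb{E}[f_t(\bm{w}_t)]-f_t(\bm{w}_t^\star))$.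
   Formalization: Quasar-convexity is proved for w in W_t, not for all w in R^n, where it fails (as ‖w‖→∞ the inner product ⟨∇f_t(w), w−w_t*⟩ tends to 0 while f_t(w) does not); the requirement ρ≤1 is dropped, since 2e^{-R}>1 when R<ln 2. *)

(* Defs.v *)
From HB Require Import structures.
From mathcomp Require Import all_boot all_order all_algebra.
From mathcomp Require Import all_classical all_reals all_analysis.

Set Implicit Arguments.
Unset Strict Implicit.
Unset Printing Implicit Defensive.

Import Order.TTheory GRing.Theory Num.Theory.
Import numFieldNormedType.Exports.

Local Open Scope classical_set_scope.
Local Open Scope ring_scope.

(* The library norm [`|v|] on ['rV[R]_n] is the sup norm, hence [enorm]; the
   two induce the same topology, so [closed] and [differentiable] are the
   usual notions on the Euclidean space. *)
Definition dotp (R : realType) (n : nat) (u v : 'rV[R]_n) : R :=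
  \sum_(i < n) u ord0 i * v ord0 i.

Definition enorm (R : realType) (n : nat) (u : 'rV[R]_n) : R :=
  Num.sqrt (dotp u u).

(* The Borel sigma-algebra of ['rV[R]_n], generated by the coordinates, as the
   library does for [n.-tuple]. *)
Definition rV_display : measure_display.
Proof. exact. Qed.

Section measurable_rV.
Context (R : realType) (n : nat).

Let coord (i : 'I_n) (v : 'rV[R]_n) : R := v ord0 i.

Let rV_set0 : g_sigma_preimage coord set0.
Proof. exact: sigma_algebra0. Qed.

Let rV_setC A : g_sigma_preimage coord A -> g_sigma_preimage coord (~` A).
Proof. exact: sigma_algebraC. Qed.

Let rV_bigcup (F : _^nat) : (forall i, g_sigma_preimage coord (F i)) ->
  g_sigma_preimage coord (\bigcup_i (F i)).
Proof. exact: sigma_algebra_bigcup. Qed.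

HB.instance Definition _ := @isMeasurable.Build rV_display 'rV[R]_n
  (g_sigma_preimage coord) rV_set0 rV_setC rV_bigcup.

End measurable_rV.

(* n-dimensional Lebesgue measure of a Borel set as the iterated integral of
   its indicator, i.e. the n-fold product of the Lebesgue measure on R. *)
Fixpoint iterated_integral (R : realType) (n : nat) :
    ('rV[R]_n -> \bar R) -> \bar R :=
  match n with
  | 0 => fun f => f 0
  | n'.+1 => fun f =>
      (\int[@lebesgue_measure R]_x
         iterated_integral (fun v : 'rV[R]_n' => f (row_mx x%:M v)))%E
  end.

Definition lebesgue_rV (R : realType) (n : nat) (A : set 'rV[R]_n) : \bar R :=
  iterated_integral (fun v => (\1_A v)%:E).

Definition is_diam (R : realType) (n : nat) (W : set 'rV[R]_n) (D : R) : Prop :=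
  (forall u v, W u -> W v -> enorm (u - v) <= D) /\
  (exists u v, [/\ W u, W v & enorm (u - v) = D]).

Definition is_minimizer (R : realType) (n : nat) (f : 'rV[R]_n -> R)
    (wstar : 'rV[R]_n) : Prop :=
  forall w, f wstar <= f w.

Definition grad (R : realType) (n : nat) (f : 'rV[R]_n -> R) (w : 'rV[R]_n) :
    'rV[R]_n :=
  \row_i 'D_(delta_mx ord0 i) f w.

(* [S = setT] is quasar-convexity on the whole space.  For [1 < rho] the
   inequality is stronger than the one for [rho = 1], since the inner product is
   then nonpositive; so no upper bound on [rho] is imposed. *)
Definition quasar_convex_on (R : realType) (n : nat) (S : set 'rV[R]_n)
    (rho : R) (f : 'rV[R]_n -> R) (wstar : 'rV[R]_n) : Prop :=
  [/\ 0 < rho, (forall w, differentiable f w), is_minimizer f wstar &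
      forall w, S w ->
        f wstar >= f w + rho^-1 * dotp (grad f w) (wstar - w)].

Definition weakly_smooth (R : realType) (n : nat) (Gamma : R)
    (f : 'rV[R]_n -> R) (wstar : 'rV[R]_n) : Prop :=
  [/\ (forall w, differentiable f w), is_minimizer f wstar &
      forall w, enorm (grad f w) ^+ 2 <= Gamma * (f w - f wstar)].

Definition euclidean_lipschitz (R : realType) (n : nat) (K : R)
    (f : 'rV[R]_n -> R) : Prop :=
  forall u v, `|f u - f v| <= K * enorm (u - v).

Definition logistic (R : realType) (z : R) : R := (1 + expR (- z))^-1.

Definition glm_loss (R : realType) (n : nat) (P : probability 'rV[R]_n R)
    (sigma : R -> R) (wstar w : 'rV[R]_n) : R :=
  \int[P]_x (2^-1 * (sigma (dotp w x) - sigma (dotp wstar x)) ^+ 2).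

(* The label of the sample [x i] is [sigma (dotp wstar (x i))]. *)
Definition glm_stoch_grad (R : realType) (n m : nat) (sigma : R -> R)
    (wstar : 'rV[R]_n) (x : 'I_m -> 'rV[R]_n) (w : 'rV[R]_n) : 'rV[R]_n :=
  m%:R^-1 *: \sum_(i < m)
    ((sigma (dotp w (x i)) - sigma (dotp wstar (x i))) *
       derive1 sigma (dotp w (x i))) *: x i.

Definition is_proj (R : realType) (n : nat) (W : set 'rV[R]_n)
    (v p : 'rV[R]_n) : Prop :=
  W p /\ forall q, W q -> enorm (v - p) <= enorm (v - q).

Definition mutually_independent d d' (Omega : measurableType d)
    (E : measurableType d') (R : realType) (Pr : probability Omega R)
    (I : finType) (X : I -> Omega -> E) : Prop :=
  forall (J : {set I}) (A : I -> set E), (forall i, measurable (A i)) ->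
    Pr (\bigcap_(i in [set` J]) X i @^-1` A i) =
    (\prod_(i in J) Pr (X i @^-1` A i))%E.

(* The samples [x t i], [1 <= t <= T], [i < m], are mutually independent across
   both indices, so the batch drawn at time [t] is independent of the earlier
   ones. *)
Definition iid_samples d (Omega : measurableType d) (R : realType) (n : nat)
    (Pr : probability Omega R) (P : probability 'rV[R]_n R) (T m : nat)
    (x : nat -> 'I_m -> {RV Pr >-> 'rV[R]_n}) : Prop :=
  (forall t i A, (1 <= t <= T)%N -> measurable A ->
     distribution Pr (x t i) A = P A) /\
  mutually_independent Pr
    (fun ti : 'I_T * 'I_m => x ti.1.+1 ti.2 : Omega -> 'rV[R]_n).

(* [w t] is the random iterate at time [t] and [g t omega] maps a point to the
   stochastic gradient computed there from the batch drawn at time [t]. *)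
Definition online_pgd (R : realType) (n : nat) (Omega : Type) (T : nat)
    (W : nat -> set 'rV[R]_n) (alpha : R) (w1 : 'rV[R]_n)
    (g : nat -> Omega -> 'rV[R]_n -> 'rV[R]_n) (w : nat -> Omega -> 'rV[R]_n) :
    Prop :=
  (forall omega, w 1 omega = w1) /\
  (forall t omega, (1 <= t < T)%N ->
     is_proj (W t.+1) (w t omega - alpha *: g t omega (w t omega))
       (w t.+1 omega)).

Definition regret d (Omega : measurableType d) (R : realType) (n : nat)
    (Pr : probability Omega R) (f : nat -> 'rV[R]_n -> R)
    (wstar : nat -> 'rV[R]_n) (w : nat -> Omega -> 'rV[R]_n) (T : nat) :
    \bar R :=
  (\sum_(1 <= t < T.+1)
     ('E_Pr[fun omega => f t (w t omega)] - (f t (wstar t))%:E))%E.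

(* Main.v *)
(* The logistic function satisfies [s' = s (1 - s) <= 1/4] and
   [s'(c) <= exp |a - c| * s'(a)].  With the mean value theorem this gives
   [(s a - s b) s'(a) (a - b) >= exp (- D) (s a - s b)^2] when [|a - b| <= D],
   and integrating the pointwise bounds over [P] gives quasar-convexity, weak
   smoothness and Lipschitz continuity of the losses.  A quadratic Taylor bound
   of the integrand replaces differentiation under the integral sign.

   For the regret, the potential is [Phi_t = |w_t - wstar_t|^2].  One step gives
   [Phi_(t+1) <= Phi_t - c f_t(w_t) + <e_t, v(w_t)> + alpha^2 |e_t|^2
                 + 2 D |wstar_t - wstar_(t+1)|]
   with [c = 4 alpha exp (- D) - alpha^2 / 8] and
   [v = 2 alpha^2 grad f_t - 2 alpha (. - wstar_t)].  The iterate [w_t] is a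
   measurable function of the samples drawn before time [t], hence independent
   of the batch at time [t], and by Fubini the inner product with [v] has mean
   zero.  Taking expectations and telescoping bounds the losses up to time
   [T - 1]; the last one is absorbed by [Phi_T]. *)

Require Import Defs.
From HB Require Import structures.
From mathcomp Require Import all_boot all_order all_algebra.
From mathcomp Require Import all_classical all_reals all_analysis.
From mathcomp Require Import measurable_realfun ring lra.

Import Order.TTheory GRing.Theory Num.Theory.
Import numFieldNormedType.Exports.

Local Open Scope classical_set_scope.
Local Open Scope ring_scope.

(** * Euclidean inner product and norm on row vectors *)

Section dot_product.
Context {R : realType} {n : nat}.
Implicit Types u v w : 'rV[R]_n.

Lemma dotpC u v : dotp u v = dotp v u.
Proof. by apply: eq_bigr => i _; rewrite mulrC. Qed.

Lemma dotpDl u v w : dotp (u + v) w = dotp u w + dotp v w.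
Proof.
by rewrite /dotp -big_split/=; apply: eq_bigr => i _; rewrite mxE mulrDl.
Qed.

Lemma dotpZl a u w : dotp (a *: u) w = a * dotp u w.
Proof.
by rewrite /dotp mulr_sumr; apply: eq_bigr => i _; rewrite mxE mulrA.
Qed.

Lemma dotpNl u w : dotp (- u) w = - dotp u w.
Proof. by rewrite -scaleN1r dotpZl mulN1r. Qed.

Lemma dotp0l w : dotp 0 w = 0.
Proof. by rewrite -(scale0r 0) dotpZl mul0r. Qed.

Lemma dotpBl u v w : dotp (u - v) w = dotp u w - dotp v w.
Proof. by rewrite dotpDl dotpNl. Qed.

Lemma dotpDr u v w : dotp w (u + v) = dotp w u + dotp w v.
Proof. by rewrite dotpC dotpDl !(dotpC w). Qed.

Lemma dotpZr a u w : dotp w (a *: u) = a * dotp w u.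
Proof. by rewrite dotpC dotpZl (dotpC w). Qed.

Lemma dotpNr u w : dotp w (- u) = - dotp w u.
Proof. by rewrite dotpC dotpNl (dotpC w). Qed.

Lemma dotpBr u v w : dotp w (u - v) = dotp w u - dotp w v.
Proof. by rewrite dotpDr dotpNr. Qed.

Lemma dotp_suml (I : finType) (F : I -> 'rV[R]_n) w :
  dotp (\sum_i F i) w = \sum_i dotp (F i) w.
Proof.
apply: (big_morph (fun u => dotp u w)) => [u v|]; last exact: dotp0l.
exact: dotpDl.
Qed.

Lemma dotp_delta u j : dotp u (delta_mx ord0 j) = u ord0 j.
Proof.
rewrite /dotp (bigD1 j)//= big1 => [|i ij].
  by rewrite mxE !eqxx mulr1 addr0.
by rewrite mxE (negbTE ij) andbF mulr0.
Qed.

Lemma dotp_ge0 u : 0 <= dotp u u.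
Proof. by apply: sumr_ge0 => i _; rewrite -expr2 sqr_ge0. Qed.

Lemma enorm_ge0 u : 0 <= enorm u.
Proof. exact: sqrtr_ge0. Qed.

Lemma sqr_enorm u : enorm u ^+ 2 = dotp u u.
Proof. by rewrite sqr_sqrtr// dotp_ge0. Qed.

Lemma enorm0 : enorm (0 : 'rV[R]_n) = 0.
Proof. by rewrite /enorm dotp0l sqrtr0. Qed.

Lemma dotp_eq0 u : dotp u u = 0 -> u = 0.
Proof.
move=> /eqP; rewrite psumr_eq0; last by move=> i _; rewrite -expr2 sqr_ge0.
move=> /allP u0; apply/rowP => i.
have := u0 i (mem_index_enum _).
by rewrite mxE mulf_eq0 orbb => /eqP.
Qed.

(* Expand [|b u - a v|^2 >= 0] with [a = |u|] and [b = |v|]. *)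
Lemma cauchy_schwarz u v : dotp u v <= enorm u * enorm v.
Proof.
have := dotp_ge0 (enorm v *: u - enorm u *: v).
rewrite !(dotpBl, dotpBr, dotpZl, dotpZr) -!sqr_enorm (dotpC v u).
move: (enorm_ge0 u) (enorm_ge0 v).
rewrite le_eqVlt => /predU1P[u0 _ _|u0].
  have /dotp_eq0 -> : dotp u u = 0 by rewrite -sqr_enorm -u0 expr0n.
  by rewrite dotp0l enorm0 mul0r.
rewrite le_eqVlt => /predU1P[v0 _|v0].
  have /dotp_eq0 -> : dotp v v = 0 by rewrite -sqr_enorm -v0 expr0n.
  by rewrite dotpC dotp0l enorm0 mulr0.
move=> h; rewrite -subr_ge0 -(pmulr_rge0 _ (mulr_gt0 u0 v0)).
by nra.
Qed.

Lemma enormN u : enorm (- u) = enorm u.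
Proof. by rewrite /enorm dotpNl dotpNr opprK. Qed.

Lemma enormZ a u : enorm (a *: u) = `|a| * enorm u.
Proof.
by rewrite /enorm dotpZl dotpZr mulrA -expr2 sqrtrM ?sqr_ge0// sqrtr_sqr.
Qed.

Lemma normr_dotp_le u v : `|dotp u v| <= enorm u * enorm v.
Proof.
rewrite ler_norml cauchy_schwarz andbT lerNl -dotpNl -(enormN u).
exact: cauchy_schwarz.
Qed.

Lemma enormD u v : enorm (u + v) <= enorm u + enorm v.
Proof.
rewrite -(@ler_pXn2r _ 2) ?nnegrE ?addr_ge0 ?enorm_ge0//.
rewrite sqr_enorm dotpDl !dotpDr (dotpC v u) sqrrD -!sqr_enorm.
by have := cauchy_schwarz u v; lra.
Qed.

Lemma enormB u v : enorm (u - v) = enorm (v - u).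
Proof. by rewrite -enormN opprB. Qed.

Lemma normr_coord_le u i : `|u ord0 i| <= enorm u.
Proof.
rewrite -(@ler_pXn2r _ 2) ?nnegrE ?enorm_ge0//.
rewrite sqr_enorm real_normK ?num_real// expr2 /dotp (bigD1 i)//= lerDl.
by apply: sumr_ge0 => j _; rewrite -expr2 sqr_ge0.
Qed.

Lemma enorm_le_sum u : enorm u <= \sum_(i < n) `|u ord0 i|.
Proof.
rewrite -(@ler_pXn2r _ 2) ?nnegrE ?enorm_ge0 ?sumr_ge0//.
rewrite sqr_enorm expr2 mulr_suml; apply: ler_sum => i _.
rewrite (le_trans (ler_norm _))// normrM ler_wpM2l//.
by rewrite (bigD1 i)//= lerDl sumr_ge0.
Qed.

Lemma enorm_le_coord u b : (forall i, `|u ord0 i| <= b) -> enorm u <= n%:R * b.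
Proof.
move=> ub; rewrite (le_trans (enorm_le_sum u))//.
rewrite (le_trans (ler_sum _ (fun i _ => ub i)))//.
by rewrite sumr_const card_ord mulr_natl.
Qed.

(** Comparison with the library's sup norm, in which continuity and little-o are expressed. *)
Lemma enorm_le_norm u : enorm u <= n%:R * `|u|.
Proof.
apply: enorm_le_coord => i; rewrite [leRHS]mx_normrE.
exact: (le_bigmax _ (fun ij => `|u ij.1 ij.2|) (ord0, i)).
Qed.

End dot_product.

(** * Borel measurability of vector-valued maps *)

Section measurable_row_vectors.
Context {R : realType} {n : nat}.

Lemma measurable_coord (i : 'I_n) :
  measurable_fun [set: 'rV[R]_n] (fun v => v ord0 i).
Proof.
move=> _ Y mY; rewrite setTI; apply: sub_sigma_algebra => /=.
rewrite -bigcup_seq/=; exists i => /=; first by rewrite mem_index_enum.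
by exists Y => //; rewrite setTI.
Qed.

(** For the converse, the sets with measurable preimage under [f] form a sigma-algebra, and by
    assumption it contains the preimages of Borel sets under the coordinates. *)
Lemma measurable_rVP d (T : measurableType d) (f : T -> 'rV[R]_n) :
  measurable_fun [set: T] f <->
  forall i, measurable_fun [set: T] (fun x => f x ord0 i).
Proof.
split=> [mf i|mf].
  by apply: (measurableT_comp (measurable_coord i)).
move=> _ A mA; rewrite setTI.
suff : g_sigma_preimage (fun (i : 'I_n) (v : 'rV[R]_n) => v ord0 i) `<=`
       [set B | measurable (f @^-1` B)] by exact.
apply: smallest_sub.
  split => [|B mB|F mF] /=.
  - by rewrite preimage_set0.
  - by rewrite setTD preimage_setC; exact: measurableC.
  - by rewrite preimage_bigcup; exact: bigcupT_measurable.
rewrite -bigcup_seq; apply: bigcup_sub => i _ B [C mC <-]/=.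
by rewrite setTI -[X in measurable X]setTI; exact: mf.
Qed.

Lemma measurable_dotp d (T : measurableType d) (f g : T -> 'rV[R]_n) :
  measurable_fun [set: T] f -> measurable_fun [set: T] g ->
  measurable_fun [set: T] (fun x => dotp (f x) (g x)).
Proof.
move=> /measurable_rVP mf /measurable_rVP mg.
by apply: measurable_sum => i; exact: measurable_funM.
Qed.

Lemma measurable_enorm d (T : measurableType d) (f : T -> 'rV[R]_n) :
  measurable_fun [set: T] f -> measurable_fun [set: T] (fun x => enorm (f x)).
Proof.
move=> mf; apply: (measurableT_comp (continuous_measurable_fun
  (@sqrt_continuous R))).
exact: measurable_dotp.
Qed.

Lemma measurable_rVD d (T : measurableType d) (f g : T -> 'rV[R]_n) :
  measurable_fun [set: T] f -> measurable_fun [set: T] g ->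
  measurable_fun [set: T] (fun x => f x + g x).
Proof.
move=> /measurable_rVP mf /measurable_rVP mg; apply/measurable_rVP => i.
by under eq_fun do rewrite mxE; exact: measurable_funD.
Qed.

Lemma measurable_rVZ d (T : measurableType d) (a : T -> R) (f : T -> 'rV[R]_n) :
  measurable_fun [set: T] a -> measurable_fun [set: T] f ->
  measurable_fun [set: T] (fun x => a x *: f x).
Proof.
move=> ma /measurable_rVP mf; apply/measurable_rVP => i.
by under eq_fun do rewrite mxE; exact: measurable_funM.
Qed.

Lemma measurable_rV_sum d (T : measurableType d) (I : finType)
    (f : I -> T -> 'rV[R]_n) :
  (forall i, measurable_fun [set: T] (f i)) ->
  measurable_fun [set: T] (fun x => \sum_i f i x).
Proof.
move=> mf; apply/measurable_rVP => j.
under eq_fun do rewrite summxE.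
by apply: measurable_sum => i; move/measurable_rVP : (mf i).
Qed.

(* Openness is expressed with coordinate boxes; by density of the rationals such
   a set is a countable union of boxes. *)
Lemma measurable_open_boxes (U : set 'rV[R]_n) :
  (forall u, U u -> exists2 e : R, 0 < e &
     forall v : 'rV[R]_n, (forall i, `|v ord0 i - u ord0 i| < e) -> U v) ->
  measurable U.
Proof.
move=> Uo.
pose box (q : 'rV[rat]_n) (k : nat) : set 'rV[R]_n :=
  \bigcap_(i in [set: 'I_n])
    (fun v : 'rV[R]_n => v ord0 i) @^-1` [set y | `|y - ratr (q ord0 i)| <
      k.+1%:R^-1].
have mbox q k : measurable (box q k).
  apply: fin_bigcap_measurable; first exact: finite_finset.
  move=> i _; rewrite -[X in measurable X]setTI; apply: measurable_coord => //.
  have -> : [set y : R | `|y - ratr (q ord0 i)| < k.+1%:R^-1] =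
            ball (ratr (q ord0 i) : R) k.+1%:R^-1.
    by apply/seteqP; split => y /=; rewrite -ball_normE/= distrC.
  exact: measurable_ball.
have -> : U = \bigcup_(p in [set p : 'rV[rat]_n * nat | box p.1 p.2 `<=` U])
                box p.1 p.2.
  apply/seteqP; split => [u Uu|u [p /= pU]]; last exact: pU.
  have [e e0 eU] := Uo _ Uu.
  (* The half is needed because [u] and [v] are each within [k.+1%:R^-1] of the rational centre. *)
  have [k ke] : exists k : nat, k.+1%:R^-1 < e / 2.
    have := @ltr_add_invr _ 0 (e / 2) (divr_gt0 e0 (ltr0Sn R 1)).
    by case=> k; rewrite add0r => ke; exists k.
  have /choice[q qP] (i : 'I_n) :
      exists q : rat, `|u ord0 i - ratr q| < k.+1%:R^-1.
    have [|q] := @rat_in_itvoo R (u ord0 i - k.+1%:R^-1) (u ord0 i +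
      k.+1%:R^-1).
      by rewrite ltrD2l gtrN// invr_gt0.
    rewrite in_itv/= => /andP[q1 q2]; exists q.
    by rewrite distrC ltr_distl q1 q2.
  exists (\row_i q i, k) => /=; last by move=> i _ /=; rewrite mxE.
  move=> v /= vq; apply: eU => i.
  have := vq i I; rewrite /= mxE => vqi; have := qP i.
  rewrite -(subrK (ratr (q i)) (v ord0 i)) -addrA => uqi.
  rewrite (le_lt_trans (ler_normD _ _))// (splitr e) ltrD ?(lt_trans _ ke)//.
  by rewrite distrC.
rewrite bigcup_mkcond; apply: countable_bigcupT_measurable.
  exact: countableP.
by move=> p; case: ifP.
Qed.

(** The bound makes [p] a Lipschitz function of [u], so that [[set x | a < p x]] is the preimage
    under [u] of an open set. This gives measurability of the losses, of their gradients and of the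
    projected iterates. *)
Lemma measurable_lipschitz_of d (T : measurableType d) (u : T -> 'rV[R]_n)
    (p : T -> R) (L : R) : measurable_fun [set: T] u ->
  (forall x y, p x - p y <= L * enorm (u x - u y)) ->
  measurable_fun [set: T] p.
Proof.
move=> mu pL.
move=> mD; apply: (measurability _ (RGenOInfty.measurableE R)) => //.
move=> _ [_ [a ->] <-]; rewrite setTI preimage_itvoy.
(* [U] is a union of open Euclidean balls around the points [u x] with [a < p x], whose radii are
   the slack [p x - a] divided by the Lipschitz constant. *)
pose U := [set v | exists2 x, a < p x & `|L| * enorm (u x - v) < p x - a].
have -> : [set x | a < p x] = u @^-1` U.
  apply/seteqP; split => [x /= ax|x /= [y ay]].
    by exists x => //; rewrite subrr enorm0 mulr0 subr_gt0.
  move=> yx; have := pL y x.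
  have : L * enorm (u y - u x) <= `|L| * enorm (u y - u x).
    by rewrite ler_wpM2r ?enorm_ge0// ler_norm.
  by lra.
rewrite -[X in measurable X]setTI; apply: mu => //.
apply: measurable_open_boxes => v [x ax vx].
have c0 : 0 < `|L| * n%:R + 1 by rewrite ltr_wpDl// mulr_ge0.
(* A coordinatewise bound [r] gives a Euclidean one of [n%:R * r]; the [+ 1] keeps the denominator
   positive. *)
exists ((p x - a - `|L| * enorm (u x - v)) / (`|L| * n%:R + 1)).
  by rewrite divr_gt0// subr_gt0.
move=> w wv; exists x => //.
have -> : u x - w = (u x - v) + (v - w) by rewrite addrA subrK.
rewrite -subr_gt0 in vx; set e := p x - a - _ in vx wv.
have ew : enorm (v - w) <= n%:R * (e / (`|L| * n%:R + 1)).
  by rewrite enormB; apply: enorm_le_coord => i; rewrite !mxE ltW.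
have := enormD (u x - v) (v - w) => /(ler_wpM2l (normr_ge0 L)).
rewrite mulrDr => /le_lt_trans; apply.
rewrite -ltrBrDl -/e (le_lt_trans (ler_wpM2l (normr_ge0 L) ew))//.
rewrite 2!mulrA ltr_pdivrMr// mulrA [ltRHS]mulrC ltr_pM2r//.
by rewrite ltrDl ltr01.
Qed.

End measurable_row_vectors.

(** * Scalar estimates for the logistic function and the squared residual *)

Section logistic.
Context {R : realType}.
Implicit Types a b c z : R.
Local Notation sigma := (@logistic R).

Lemma logistic_gt0 z : 0 < sigma z.
Proof. by rewrite invr_gt0 addr_gt0// expR_gt0. Qed.

Lemma logistic_lt1 z : sigma z < 1.
Proof.
by rewrite invf_lt1 ?ltrDl ?expR_gt0// addr_gt0// expR_gt0.
Qed.

Global Instance is_derive_logistic z :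
  is_derive z 1 sigma (sigma z * (1 - sigma z)).
Proof.
have e0 : 1 + expR (- z) != 0 by rewrite gt_eqF// addr_gt0// expR_gt0.
have -> : @logistic R = (fun x => (1 + expR (- x))^-1) by [].
apply: is_derive_eq.
rewrite /logistic /GRing.scale/=.
by field.
Qed.

Lemma derive1_logistic z : derive1 sigma z = sigma z * (1 - sigma z).
Proof. by rewrite derive1E derive_val. Qed.

Lemma derive1_logistic_ge0 z : 0 <= derive1 sigma z.
Proof.
rewrite derive1_logistic.
by have := logistic_gt0 z; have := logistic_lt1 z; nra.
Qed.

Lemma derive1_logistic_le z : derive1 sigma z <= 4^-1.
Proof.
by rewrite derive1_logistic; have := sqr_ge0 (sigma z - 2^-1); nra.
Qed.

(** The location of [c] is given by a distance to [a], which covers both orders of [a] and [b] and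
    is the form that [derive1_logistic_ratio] consumes. *)
Lemma logistic_MVT a b :
  exists2 c, `|a - c| <= `|a - b| & sigma a - sigma b = derive1 sigma c * (a -
    b).
Proof.
have mvt x y : x <= y -> exists2 c, c \in `[x, y] &
    sigma y - sigma x = derive1 sigma c * (y - x).
  move=> xy; have [|c cxy ->] := MVT_segment xy (fun x _ =>
    is_derive_logistic x).
    by apply: derivable_within_continuous => z _; exact: ex_derive.
  by exists c; rewrite // derive1_logistic.
have [/mvt|/ltW/mvt] := leP a b => -[c /[!in_itv]/= /andP[ac cb] e]; exists c.
- by rewrite (distrC a) (distrC a) !ger0_norm ?subr_ge0 ?lerD2r// (le_trans ac).
- by rewrite -[LHS]opprB e -mulrN opprB.
- by rewrite !ger0_norm ?subr_ge0 ?lerD2l ?lerN2// (le_trans ac).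
- by [].
Qed.

Lemma logistic_lipschitz a b : `|sigma a - sigma b| <= 4^-1 * `|a - b|.
Proof.
have [c _ ->] := logistic_MVT a b.
rewrite normrM ler_wpM2r// ger0_norm ?derive1_logistic_ge0//.
exact: derive1_logistic_le.
Qed.

(* In terms of [p = exp (- a)] the derivative is [p / (1 + p) ^+ 2], so that
   the ratio of two values is at most [max (p / q) (q / p)]. *)
Lemma derive1_logistic_ratio a c D : `|a - c| <= D ->
  expR (- D) * derive1 sigma c <= derive1 sigma a.
Proof.
move=> acD; have key : expR (- `|a - c|) * derive1 sigma c <= derive1 sigma a.
  have pq : expR (- a) = expR (c - a) * expR (- c).
    by rewrite -expRD; congr expR; ring.
  have E z : derive1 sigma z = expR (- z) / (1 + expR (- z)) ^+ 2.
    rewrite derive1_logistic /logistic; field.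
    by rewrite gt_eqF// addr_gt0// expR_gt0.
  rewrite !E mulrA ler_pdivrMr ?exprn_gt0 ?addr_gt0 ?expR_gt0//.
  rewrite mulrAC ler_pdivlMr ?exprn_gt0 ?addr_gt0 ?expR_gt0// mulrAC.
  move: (expR_gt0 (- a)) (expR_gt0 (- c)).
  have [ac|/ltW ac] := leP a c.
    have -> : expR (- `|a - c|) = expR (a - c).
      by rewrite distrC ger0_norm ?subr_ge0// opprB.
    have : expR (- c) <= expR (- a) by rewrite ler_expR lerN2.
    have : expR (a - c) * expR (- a) = expR (- c).
      by rewrite -expRD; congr expR; ring.
    move: (expR (a - c)) (expR (- a)) (expR (- c)) => k p q kp qp p0 q0.
    (* Multiplication by [p], with [k * p = q], makes both sides squares; the claim becomes
       [q * (1 + p) <= p * (1 + q)]. *)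
    rewrite -(ler_pM2l p0).
    have -> : p * (k * (1 + p) ^+ 2 * q) = (q * (1 + p)) ^+ 2.
      by rewrite exprMn (expr2 q) -{2}kp; ring.
    have -> : p * (p * (1 + q) ^+ 2) = (p * (1 + q)) ^+ 2 by ring.
    rewrite ler_pXn2r ?nnegrE ?mulr_ge0 ?addr_ge0 ?(ltW p0) ?(ltW q0)//.
    by rewrite !mulrDr !mulr1 (mulrC q) lerD2r.
  have -> : expR (- `|a - c|) = expR (c - a).
    by rewrite ger0_norm ?subr_ge0// opprB.
  have : expR (- a) <= expR (- c) by rewrite ler_expR lerN2.
  have : expR (c - a) * expR (- c) = expR (- a).
    by rewrite -expRD; congr expR; ring.
  move: (expR (c - a)) (expR (- a)) (expR (- c)) => k p q kq pq0 p0 q0.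
  rewrite mulrAC kq ler_wpM2l ?(ltW p0)//.
  by rewrite ler_pXn2r ?nnegrE ?addr_ge0 ?lerD2l ?(ltW p0) ?(ltW q0).
rewrite (le_trans _ key)// ler_wpM2r ?derive1_logistic_ge0//.
by rewrite ler_expR lerN2.
Qed.

(** Both residuals become [s * (a - b)], with [s] the slope at an intermediate point, and
    [derive1_logistic_ratio] bounds [exp (- D) * s] by the slope at [a]. *)
Lemma logistic_quasar a b D : `|a - b| <= D ->
  expR (- D) * (sigma a - sigma b) ^+ 2 <=
  (sigma a - sigma b) * derive1 sigma a * (a - b).
Proof.
move=> abD; have [c cab e] := logistic_MVT a b.
have := derive1_logistic_ratio _ _ _ (le_trans cab abD).
rewrite e; have := derive1_logistic_ge0 c.
move: (derive1 sigma c) (derive1 sigma a) => s t s0 st.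
have -> : expR (- D) * (s * (a - b)) ^+ 2 =
          (expR (- D) * s) * (s * (a - b) ^+ 2) by ring.
have -> : s * (a - b) * t * (a - b) = t * (s * (a - b) ^+ 2) by ring.
by rewrite ler_wpM2r// mulr_ge0// sqr_ge0.
Qed.

(** The remainder is [s] times the difference of the slopes at [c] and [a]. That difference factors
    through [sigma c - sigma a], at most [|s| / 4], with a cofactor of absolute value at most 1. *)
Lemma logistic_taylor a s :
  `|sigma (a + s) - sigma a - derive1 sigma a * s| <= 4^-1 * s ^+ 2.
Proof.
have [c cab e] := logistic_MVT a (a + s).
rewrite opprD addrA subrr add0r normrN in cab e.
rewrite -[_ - sigma a]opprB e mulrN opprK -mulrBl normrM -(real_normK (num_real
  s)) expr2 mulrA ler_wpM2r//.
have -> : derive1 sigma c - derive1 sigma a =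
  (sigma c - sigma a) * (1 - sigma c - sigma a).
  by rewrite !derive1_logistic; ring.
rewrite normrM -[leRHS]mulr1.
apply: ler_pM => //.
  by rewrite (le_trans (logistic_lipschitz c a))// ler_wpM2l// distrC.

rewrite ler_norml.
have := logistic_gt0 c; have := logistic_lt1 c.
have := logistic_gt0 a; have := logistic_lt1 a.
by move=> *; apply/andP; split; lra.
Qed.

Lemma sqr_loss_quadratic a b : 2^-1 * (sigma a - sigma b) ^+ 2 <= 32^-1 * (a -
  b) ^+ 2.
Proof.
have := logistic_lipschitz a b.
rewrite -(@ler_pXn2r _ 2) ?nnegrE ?mulr_ge0// exprMn !real_normK ?num_real//.
by lra.
Qed.

Lemma normr_logistic_sub a b : `|sigma a - sigma b| <= 1.
Proof.
rewrite ler_norml; have := logistic_gt0 a; have := logistic_lt1 a.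
have := logistic_gt0 b; have := logistic_lt1 b.
by move=> *; apply/andP; split; lra.
Qed.

Lemma sqr_loss_le1 a b : 2^-1 * (sigma a - sigma b) ^+ 2 <= 1.
Proof.
have := normr_logistic_sub a b.
rewrite -(@ler_pXn2r _ 2) ?nnegrE// real_normK ?num_real// expr1n.
by lra.
Qed.

Lemma sqr_loss_lipschitz b a c :
  `|2^-1 * (sigma a - sigma b) ^+ 2 - 2^-1 * (sigma c - sigma b) ^+ 2|
  <= 4^-1 * `|a - c|.
Proof.
have -> : 2^-1 * (sigma a - sigma b) ^+ 2 - 2^-1 * (sigma c - sigma b) ^+ 2 =
  (sigma a - sigma c) * (2^-1 * ((sigma a - sigma b) + (sigma c - sigma b))).
  by field.
rewrite normrM -[leRHS]mulr1; apply: ler_pM; rewrite ?logistic_lipschitz//.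
rewrite normrM ger0_norm//.
have := ler_normD (sigma a - sigma b) (sigma c - sigma b).
by have := normr_logistic_sub a b; have := normr_logistic_sub c b; lra.
Qed.

(** With [t] the increment of [sigma], the remainder is the residual times the remainder of
    [logistic_taylor], plus [t ^+ 2 / 2]. The two parts are at most [s ^+ 2 / 4] and
    [s ^+ 2 / 32]. *)
Lemma sqr_loss_taylor b a s :
  `|2^-1 * (sigma (a + s) - sigma b) ^+ 2 - 2^-1 * (sigma a - sigma b) ^+ 2
    - (sigma a - sigma b) * derive1 sigma a * s| <= s ^+ 2.
Proof.
set t := sigma (a + s) - sigma a.
have -> : 2^-1 * (sigma (a + s) - sigma b) ^+ 2
    - 2^-1 * (sigma a - sigma b) ^+ 2
    - (sigma a - sigma b) * derive1 sigma a * s =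
  (sigma a - sigma b) * (t - derive1 sigma a * s) + 2^-1 * t ^+ 2.
  by rewrite /t; field.
have h1 := sqr_loss_quadratic (a + s) a.
rewrite -/t addrAC subrr add0r in h1.
have h2 := logistic_taylor a s; rewrite -/t in h2.
have h3 : `|(sigma a - sigma b) * (t - derive1 sigma a * s)| <= 1 * (4^-1 * s
  ^+ 2).
  by rewrite normrM ler_pM// normr_logistic_sub.
rewrite (le_trans (ler_normD _ _))//.
rewrite (ger0_norm (mulr_ge0 _ (sqr_ge0 t)))//.
by have := sqr_ge0 s; lra.
Qed.

(** The derivative in [a] of the squared loss [(sigma a - sigma b) ^+ 2 / 2]. *)
Definition logistic_residual_grad b a : R := (sigma a - sigma b) * derive1
  sigma a.

Lemma normr_residual_grad b a :
  `|logistic_residual_grad b a| <= 4^-1 * `|sigma a - sigma b|.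
Proof.
rewrite normrM mulrC ler_wpM2r// ger0_norm ?derive1_logistic_ge0//.
exact: derive1_logistic_le.
Qed.

Lemma residual_grad_le b a : `|logistic_residual_grad b a| <= 4^-1.
Proof.
rewrite (le_trans (normr_residual_grad b a))// -[leRHS]mulr1.
by rewrite ler_wpM2l// normr_logistic_sub.
Qed.

(** Factoring out [sigma a - sigma c] leaves a term of size at most [1/4 + 1], so the constant is in
    fact 5/16; the value 1 suffices to derive measurability of the gradient. *)
Lemma residual_grad_lipschitz b a c :
  `|logistic_residual_grad b a - logistic_residual_grad b c| <= `|a - c|.
Proof.
rewrite /logistic_residual_grad !derive1_logistic.
have -> : (sigma a - sigma b) * (sigma a * (1 - sigma a)) -
          (sigma c - sigma b) * (sigma c * (1 - sigma c)) =
  (sigma a - sigma c) * (sigma a * (1 - sigma a) +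
     (sigma c - sigma b) * (1 - sigma a - sigma c)) by ring.
rewrite normrM (le_trans (ler_wpM2r (normr_ge0 _) (logistic_lipschitz a c)))//.
rewrite -mulrA mulrC -mulrA -[leRHS]mulr1 ler_wpM2l//.
have h1 := derive1_logistic_le a; have h0 := derive1_logistic_ge0 a.
rewrite derive1_logistic in h0 h1.
have h2 : `|(sigma c - sigma b) * (1 - sigma a - sigma c)| <= 1 * 1.
  rewrite normrM ler_pM// ?normr_logistic_sub// ler_norml.
  have := logistic_gt0 a; have := logistic_lt1 a.
  have := logistic_gt0 c; have := logistic_lt1 c.
  by move=> *; apply/andP; split; lra.
have := ler_normD (sigma a * (1 - sigma a)) ((sigma c - sigma b) * (1 - sigma a
  - sigma c)).
by rewrite (ger0_norm h0); lra.
Qed.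

Lemma continuous_logistic : continuous sigma.
Proof.
by move=> z; apply/differentiable_continuous/derivable1_diffP; exact: ex_derive.
Qed.

Lemma measurable_logistic : measurable_fun [set: R] sigma.
Proof. exact: continuous_measurable_fun continuous_logistic. Qed.

End logistic.

(** * Real-valued integrals against a probability measure *)

Section probability_integrals.
Context d (T : measurableType d) (R : realType) (mu : probability T R).
Implicit Types f g : T -> R.
Local Notation L1 f := (mu.-integrable [set: T] (EFin \o f)).

Lemma ae_bounded_integrable f (M : R) : measurable_fun [set: T] f ->
  {ae mu, forall x, `|f x| <= M} -> L1 f.
Proof.
move=> mf fM; have mf' : measurable_fun [set: T] (EFin \o f).
  exact/measurable_EFinP.
apply/integrableP; split => //; apply: (@le_lt_trans _ _ (`|M|%:E * mu setT)%E).
  apply: integral_le_bound => //.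
  by apply: filterS fM => x fxM _; rewrite lee_fin (le_trans fxM)// ler_norm.
by rewrite probability_setT mule1 ltry.
Qed.

Lemma bounded_integrable f (M : R) : measurable_fun [set: T] f ->
  (forall x, `|f x| <= M) -> L1 f.
Proof.
by move=> mf fM; apply: (ae_bounded_integrable _ M) => //; exact: aeW.
Qed.

Lemma integrable_EFinD f g : L1 f -> L1 g -> L1 (fun x => f x + g x).
Proof. by move=> If Ig; exact: (integrableD measurableT If Ig). Qed.

Lemma integrable_EFinB f g : L1 f -> L1 g -> L1 (fun x => f x - g x).
Proof. by move=> If Ig; exact: (integrableB measurableT If Ig). Qed.

Lemma integrable_EFinZ a f : L1 f -> L1 (fun x => a * f x).
Proof. by move=> If; exact: (integrableZl measurableT a If). Qed.

Lemma integrable_EFin_sum (I : finType) (f : I -> T -> R) : (forall i, L1 (f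
  i)) ->
  L1 (fun x => \sum_i f i x).
Proof.
move=> If; have -> : EFin \o (fun x => \sum_i f i x) =
    (fun x => \sum_i (f i x)%:E)%E.
  by apply/funext => x /=; rewrite sumEFin.
by apply: (integrable_sum measurableT) => i _; exact: If.
Qed.

Lemma Rintegral_sum (I : finType) (f : I -> T -> R) : (forall i, L1 (f i)) ->
  \int[mu]_x (\sum_i f i x) = \sum_i \int[mu]_x f i x.
Proof.
move=> If; rewrite /Rintegral.
under eq_integral do rewrite -sumEFin.
rewrite (integral_sum measurableT If) sum_fine// => i _.
exact: (integrable_fin_num measurableT (If i)).
Qed.

Lemma ae_le_Rintegral f g : L1 f -> L1 g -> {ae mu, forall x, f x <= g x} ->
  \int[mu]_x f x <= \int[mu]_x g x.
Proof.
move=> If Ig fg; rewrite -subr_ge0 -RintegralB//.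
have mh : measurable_fun [set: T] (fun x => g x - f x).
  by apply: measurable_funB; apply/measurable_EFinP;
    [exact: measurable_int Ig|exact: measurable_int If].
(* Almost everywhere [g - f] equals its absolute value, which is nonnegative at every point. *)
have -> : \int[mu]_x (g x - f x) = \int[mu]_x `|g x - f x|.
  congr fine; apply: ae_eq_integral => //.
  - exact/measurable_EFinP.
  - by apply/measurable_EFinP; exact: measurableT_comp.
  - by apply: filterS fg => x fgx _; rewrite ger0_norm// subr_ge0.
by apply: Rintegral_ge0.
Qed.

Lemma le_Rintegral_setT f g : L1 f -> L1 g -> (forall x, f x <= g x) ->
  \int[mu]_x f x <= \int[mu]_x g x.
Proof. by move=> If Ig fg; apply: ae_le_Rintegral => //; exact: aeW. Qed.

Lemma Rintegral_cst1 (a : R) : \int[mu]_x a = a.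
Proof.
by rewrite Rintegral_cst// -[X in fine X]/(mu setT) probability_setT mulr1.
Qed.

Lemma ae_normr_Rintegral_le f M : measurable_fun [set: T] f ->
  {ae mu, forall x, `|f x| <= M} -> `|\int[mu]_x f x| <= M.
Proof.
move=> mf fM; have If := ae_bounded_integrable _ _ mf fM.
rewrite (le_trans (le_normr_Rintegral measurableT If))// -[leRHS]Rintegral_cst1.
apply: ae_le_Rintegral => //.
  apply: (ae_bounded_integrable _ M); first exact: measurableT_comp.
  by apply: filterS fM => x; rewrite normr_id.
by apply: (bounded_integrable _ `|M|).
Qed.

End probability_integrals.

(** * Differentiability and gradient from a quadratic expansion *)

Definition dotp_fun (R : realType) (n : nat) (u : 'rV[R]_n) : 'rV[R]_n -> R^o :=
  dotp u.

Lemma dotp_fun_is_linear (R : realType) (n : nat) (u : 'rV[R]_n) :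
  linear (dotp_fun R n u).
Proof. by move=> a v w; rewrite /dotp_fun dotpDr dotpZr. Qed.

(** The linear structure, with values in the normed module [R^o], lets [dotp_fun] serve as a
    candidate differential in [diff_unique]. *)
HB.instance Definition _ (R : realType) (n : nat) (u : 'rV[R]_n) :=
  GRing.isLinear.Build R 'rV[R]_n R^o *:%R (dotp_fun R n u) (dotp_fun_is_linear
    R n u).

Section quadratic_expansion.
Context {R : realType} {n : nat} (f : 'rV[R]_n -> R) (G w : 'rV[R]_n).
Hypothesis fG : forall h, `|f (w + h) - f w - dotp G h| <= enorm h ^+ 2.

Lemma continuous_dotp_fun : continuous (dotp_fun R n G).
Proof.
apply: bounded_linear_continuous; apply/linear_boundedP.
exists (enorm G * n%:R); split; first exact: num_real.
move=> M GM v; rewrite (le_trans (normr_dotp_le _ _))//.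
rewrite (le_trans (ler_wpM2l (enorm_ge0 _) (enorm_le_norm v)))// mulrA.
by rewrite ler_wpM2r// ltW.
Qed.

Let expansion : f \o shift w = cst (f w) + dotp_fun R n G +o_ (0 : 'rV[R]_n) id.
Proof.
apply/eqaddoP => e e0.
(* On the ball of this radius [enorm h ^+ 2 <= n%:R ^+ 2 * |h| ^+ 2] is at most [e * |h|]. *)
have c0 : 0 < e / (n%:R ^+ 2 + 1) by rewrite divr_gt0// ltr_wpDl// sqr_ge0.
near=> h.
rewrite /= [X in `|X|](_ : _ = f (w + h) - f w - dotp G h); last first.
  by rewrite !fctE/= opprD addrA (addrC h).
rewrite (le_trans (fG h))//.
have hn := enorm_le_norm h.
rewrite (le_trans (lerXn2r 2 _ _ hn)) ?nnegrE ?enorm_ge0 ?mulr_ge0//.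
rewrite exprMn (expr2 `|h|) mulrA ler_wpM2r//.
have hc : `|h| <= e / (n%:R ^+ 2 + 1).
  near: h; exact: (@nbhs0_le R (matrix R 1 n : normedModType R) _ c0).
rewrite (le_trans (ler_wpM2l (sqr_ge0 _) hc))//.
rewrite mulrA ler_pdivrMr ?ltr_wpDl ?sqr_ge0//.
rewrite [leRHS]mulrC ler_wpM2r ?(ltW e0)//.
by rewrite lerDl.
Unshelve. all: by end_near. Qed.

Lemma differentiable_quadratic : differentiable f w.
Proof.
apply/diff_locallyP; rewrite (diff_unique continuous_dotp_fun expansion).
by split; [exact: continuous_dotp_fun|exact: expansion].
Qed.

Lemma grad_quadratic : grad f w = G.
Proof.
apply/rowP => i; rewrite mxE deriveE; last exact: differentiable_quadratic.
by rewrite (diff_unique continuous_dotp_fun expansion) /= /dotp_fun dotp_delta.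
Qed.

End quadratic_expansion.

(** * Differentiability, quasar-convexity, smoothness and Lipschitz bounds of the GLM loss *)

Section logistic_loss.
Context {R : realType} {n : nat} (P : probability 'rV[R]_n R).
Hypothesis x_le1 : {ae P, forall x, enorm x <= 1}.
Variable ws : 'rV[R]_n.
Local Notation sigma := (@logistic R).
Local Notation f := (glm_loss P sigma ws).
Local Notation L1 f := (P.-integrable [set: _] (EFin \o f)).

Definition sample_grad (w x : 'rV[R]_n) : 'rV[R]_n :=
  logistic_residual_grad (dotp ws x) (dotp w x) *: x.

(** The candidate gradient, obtained by formally differentiating under the integral; [grad_loss]
    identifies it with [grad f]. *)
Definition loss_grad (w : 'rV[R]_n) : 'rV[R]_n :=
  \row_j \int[P]_x (sample_grad w x) ord0 j.

Let sqr_loss w x := 2^-1 * (sigma (dotp w x) - sigma (dotp ws x)) ^+ 2.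

Let measurable_dotpr w : measurable_fun [set: 'rV[R]_n] (dotp w).
Proof. exact: measurable_dotp. Qed.

Lemma measurable_residual_grad d (T : measurableType d) (b a : T -> R) :
  measurable_fun [set: T] b -> measurable_fun [set: T] a ->
  measurable_fun [set: T] (fun x => logistic_residual_grad (b x) (a x)).
Proof.
move=> mb ma; rewrite /logistic_residual_grad.
under eq_fun do rewrite derive1_logistic.
have mla := measurableT_comp measurable_logistic ma.
have mlb := measurableT_comp measurable_logistic mb.
apply: measurable_funM; first exact: measurable_funB.
by apply: measurable_funM => //; exact: measurable_funB.
Qed.

Lemma measurable_sample_grad d (T : measurableType d) (w x : T -> 'rV[R]_n) :
  measurable_fun [set: T] w -> measurable_fun [set: T] x ->
  measurable_fun [set: T] (fun t => sample_grad (w t) (x t)).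
Proof.
move=> mw mx; apply: measurable_rVZ => //.
by apply: measurable_residual_grad; exact: measurable_dotp.
Qed.

Lemma enorm_sample_grad w x : enorm (sample_grad w x) <= 4^-1 * enorm x.
Proof. by rewrite enormZ ler_wpM2r ?enorm_ge0// residual_grad_le. Qed.

Let measurable_sqr_loss w : measurable_fun [set: 'rV[R]_n] (sqr_loss w).
Proof.
apply: measurable_funM => //; apply: measurable_funX; apply: measurable_funB.
  exact: (measurableT_comp measurable_logistic).
exact: (measurableT_comp measurable_logistic).
Qed.

Let sqr_loss_ge0 w x : 0 <= sqr_loss w x.
Proof. by rewrite mulr_ge0// sqr_ge0. Qed.

Let sqr_loss_L1 w : L1 (sqr_loss w).
Proof.
apply: (bounded_integrable _ _ _ _ _ 1) => // x.
by rewrite ger0_norm// sqr_loss_le1.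
Qed.

Let sample_grad_dotp_L1 w v : L1 (fun x => dotp (sample_grad w x) v).
Proof.
apply: (ae_bounded_integrable _ _ _ _ _ (enorm v)).
  by apply: measurable_dotp => //; exact: measurable_sample_grad.
apply: filterS x_le1 => x x1; rewrite (le_trans (normr_dotp_le _ _))//.
rewrite ler_piMl ?enorm_ge0// (le_trans (enorm_sample_grad _ _))//.
by have := enorm_ge0 x; lra.
Qed.

Let sample_grad_coord_L1 w (j : 'I_n) : L1 (fun x => sample_grad w x ord0 j).
Proof.
have := sample_grad_dotp_L1 w (delta_mx ord0 j).
by congr (_.-integrable _ _); apply/funext => x /=; rewrite dotp_delta.
Qed.

(** Reduces estimates on the gradient to pointwise scalar estimates in the sample. *)
Lemma dotp_loss_grad w v :
  dotp (loss_grad w) v = \int[P]_x dotp (sample_grad w x) v.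
Proof.
have L1c := sample_grad_coord_L1 w.
rewrite Rintegral_sum => [|j]; last first.
  have := integrable_EFinZ _ _ _ _ (v ord0 j) _ (L1c j).
  by congr (_.-integrable _ _); apply/funext => x /=; rewrite mulrC.
by apply: eq_bigr => j _; rewrite mxE RintegralZr.
Qed.

(** Integrates [sqr_loss_taylor] with [s = dotp h x], whose square is almost surely at most
    [enorm h ^+ 2]. *)
Lemma loss_taylor w h : `|f (w + h) - f w - dotp (loss_grad w) h| <= enorm h ^+
  2.
Proof.
rewrite dotp_loss_grad.
rewrite -(RintegralB measurableT (sqr_loss_L1 (w + h)) (sqr_loss_L1 w)).
rewrite -(RintegralB measurableT _ (sample_grad_dotp_L1 w h)); last first.
  exact: (integrable_EFinB _ _ _ _ _ _ (sqr_loss_L1 _) (sqr_loss_L1 _)).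
apply: ae_normr_Rintegral_le.
  apply: measurable_funB; first exact: measurable_funB.
  by apply: measurable_dotp => //; exact: measurable_sample_grad.
apply: filterS x_le1 => x x1; rewrite /sqr_loss dotpDl dotpZl (dotpC x).
rewrite (le_trans (sqr_loss_taylor _ _ _))//.
rewrite -(real_normK (num_real (dotp h x))) ler_pXn2r ?nnegrE ?enorm_ge0//.
by rewrite (le_trans (normr_dotp_le _ _))// ler_piMr ?enorm_ge0.
Qed.

Lemma differentiable_loss w : differentiable f w.
Proof.
by apply: (@differentiable_quadratic _ _ _ (loss_grad w)) => h;
  exact: loss_taylor. Qed.

Lemma grad_loss w : grad f w = loss_grad w.
Proof. by apply: grad_quadratic => h; exact: loss_taylor. Qed.

Lemma loss_star : f ws = 0.
Proof.
rewrite /glm_loss; under eq_Rintegral do rewrite subrr expr0n mulr0.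
by rewrite Rintegral_cst// mul0r.
Qed.

Lemma loss_ge0 w : 0 <= f w.
Proof. by apply: Rintegral_ge0 => x _; exact: sqr_loss_ge0. Qed.

Lemma loss_le1 w : f w <= 1.
Proof.
rewrite -[leRHS](@Rintegral_cst1 _ _ _ P); apply: le_Rintegral_setT => [||x];
  [exact: sqr_loss_L1| |exact: sqr_loss_le1].
by apply: (bounded_integrable _ _ _ _ _ `|1|).
Qed.

Lemma is_minimizer_loss : is_minimizer f ws.
Proof. by move=> w; rewrite loss_star loss_ge0. Qed.

Lemma loss_lipschitz : euclidean_lipschitz 4^-1 f.
Proof.
move=> u v; rewrite -(RintegralB measurableT (sqr_loss_L1 u) (sqr_loss_L1 v)).
apply: ae_normr_Rintegral_le.
  exact: measurable_funB.
apply: filterS x_le1 => x x1.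
rewrite (le_trans (sqr_loss_lipschitz _ _ _))// ler_wpM2l// -dotpBl.
by rewrite (le_trans (normr_dotp_le _ _))// ler_piMr ?enorm_ge0.
Qed.

(** The constant is half the square of the Lipschitz constant 1/4 of [sigma]. *)
Lemma loss_quadratic_growth w : f w <= 32^-1 * enorm (w - ws) ^+ 2.
Proof.
rewrite -[leRHS](@Rintegral_cst1 _ _ _ P); apply: ae_le_Rintegral;
  first exact: sqr_loss_L1.
  by apply: (bounded_integrable _ _ _ _ _ `|32^-1 * enorm (w - ws) ^+ 2|).
apply: filterS x_le1 => x x1.
rewrite (le_trans (sqr_loss_quadratic _ _))// ler_wpM2l// -dotpBl.
rewrite -(real_normK (num_real (dotp _ _))) ler_pXn2r ?nnegrE ?enorm_ge0//.
by rewrite (le_trans (normr_dotp_le _ _))// ler_piMr ?enorm_ge0.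
Qed.

(* Pointwise AM-GM with [g = loss_grad w]: since [logistic_residual_grad] is at
   most a quarter of the residual [r],
   [<sample_grad w x, g> <= |g|^2 / 2 + r^2 / 32]. *)
Lemma sqr_enorm_loss_grad w : enorm (loss_grad w) ^+ 2 <= 8^-1 * f w.
Proof.
set g := loss_grad w.
suff : enorm g ^+ 2 <= 2^-1 * enorm g ^+ 2 + 16^-1 * f w by lra.
have Ic : L1 (fun=> 2^-1 * enorm g ^+ 2).
  by apply: (bounded_integrable _ _ _ _ _ `|2^-1 * enorm g ^+ 2|).
rewrite [leLHS]sqr_enorm {1}/g dotp_loss_grad.
rewrite -[X in X + _](@Rintegral_cst1 _ _ _ P) -(RintegralZl _ measurableT
  (sqr_loss_L1 w)).
rewrite -(RintegralD measurableT Ic (integrable_EFinZ _ _ _ _ 16^-1 _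
  (sqr_loss_L1 w))).
apply: ae_le_Rintegral; first exact: sample_grad_dotp_L1.
  exact: (integrable_EFinD _ _ _ _ _ _ Ic (integrable_EFinZ _ _ _ _ 16^-1 _
    (sqr_loss_L1 w))).
apply: filterS x_le1 => x x1; rewrite dotpZl.
have := normr_residual_grad (dotp ws x) (dotp w x).
set r := logistic_residual_grad _ _; rewrite /sqr_loss;
  set t := sigma _ - _ => rt.
have xg : `|dotp x g| <= enorm g.
  by rewrite (le_trans (normr_dotp_le _ _))// ler_piMl ?enorm_ge0.
rewrite (le_trans (ler_norm _))// normrM.
rewrite (le_trans (ler_pM _ _ rt xg))//.
rewrite -(real_normK (num_real t)).
by have := sqr_ge0 (enorm g - 4^-1 * `|t|); nra.
Qed.

(** Integrates [logistic_quasar]: the scores differ by [dotp (w - ws) x], almost surely at most [D]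
    in absolute value. The factor 2 cancels the 1/2 in the loss. *)
Lemma loss_quasar w D : enorm (w - ws) <= D ->
  2 * expR (- D) * f w <= dotp (loss_grad w) (w - ws).
Proof.
move=> wD; rewrite dotp_loss_grad -(RintegralZl _ measurableT (sqr_loss_L1 w)).
apply: ae_le_Rintegral; first exact: (integrable_EFinZ _ _ _ _ _ _ (sqr_loss_L1
  w)).
  exact: sample_grad_dotp_L1.
apply: filterS x_le1 => x x1; rewrite dotpZl (dotpC x) dotpBl.
have := @logistic_quasar R (dotp w x) (dotp ws x) D.
rewrite -dotpBl.
have xD : `|dotp (w - ws) x| <= D.
  rewrite (le_trans (normr_dotp_le _ _))// (le_trans _ wD)//.
  by rewrite ler_piMr ?enorm_ge0.
move=> /(_ xD); rewrite dotpBl /sqr_loss /logistic_residual_grad.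
by move=> h; rewrite mulrACA (mulrC 2) mulVf// mul1r; lra.
Qed.

Lemma loss_grad_lipschitz j u v :
  loss_grad u ord0 j - loss_grad v ord0 j <= 1 * enorm (u - v).
Proof.
have E w : loss_grad w ord0 j = \int[P]_x sample_grad w x ord0 j by rewrite mxE.
rewrite mul1r.
(* Rewriting with [E] in the goal would compare [loss_grad u] and [loss_grad v]
   by unfolding the integrals, hence the variables [a] and [b]. *)
suff : forall a b, a = \int[P]_x sample_grad u x ord0 j ->
    b = \int[P]_x sample_grad v x ord0 j -> a - b <= enorm (u - v).
  by apply; exact: E.
move=> _ _ -> ->; apply: le_trans (ler_norm _) _.
have [Iu Iv] := (sample_grad_coord_L1 u j, sample_grad_coord_L1 v j).
rewrite -(RintegralB measurableT Iu Iv); apply: ae_normr_Rintegral_le.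
  by apply: measurable_funB; apply: (measurableT_comp (measurable_coord j));
    exact: measurable_sample_grad.
apply: filterS x_le1 => x x1; rewrite !mxE -mulrBl normrM.
rewrite -[leRHS]mulr1 ler_pM//; last exact: le_trans (normr_coord_le _ _) x1.
rewrite (le_trans (residual_grad_lipschitz _ _ _))// -dotpBl.
by rewrite (le_trans (normr_dotp_le _ _))// ler_piMr ?enorm_ge0.
Qed.

Lemma measurable_loss : measurable_fun [set: 'rV[R]_n] f.
Proof.
apply: (@measurable_lipschitz_of _ _ _ _ id _ 4^-1) => // x y.
by rewrite (le_trans (ler_norm _))// loss_lipschitz.
Qed.

Lemma measurable_loss_grad : measurable_fun [set: 'rV[R]_n] loss_grad.
Proof.
apply/measurable_rVP => j.
apply: (@measurable_lipschitz_of _ _ _ _ id _ 1) => // x y.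
exact: loss_grad_lipschitz.
Qed.

End logistic_loss.

(** * Euclidean projection onto a convex set *)

Section projection.
Context {R : realType} {n : nat} (W : set 'rV[R]_n).
Hypothesis W_convex : convex_set W.

Lemma convex_segment (p q : 'rV[R]_n) k : W p -> W q -> 0 <= k <= 1 ->
  W (p + k *: (q - p)).
Proof.
move=> Wp Wq /andP[k0 k1].
have := W_convex q p (Itv01 k0 k1); rewrite !inE => /(_ Wq Wp).
congr W; rewrite /conv/=.
by rewrite scalerBr scalerBl scale1r addrCA.
Qed.

(** Were the inner product [a] positive, moving from [p] a little towards [q] would stay in [W] and
    come closer to [v]. *)
Lemma proj_obtuse v p q : is_proj W v p -> W q -> dotp (v - p) (q - p) <= 0.
Proof.
move=> [Wp vp] Wq; rewrite leNgt; apply/negP => a0.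
set y := q - p in a0; set a := dotp _ _ in a0; set b := dotp y y.
have key k : 0 < k <= 1 -> 2 * a <= k * b.
  move=> /andP[k0 k1].
  have /vp : W (p + k *: (q - p)) by apply: convex_segment; rewrite ?(ltW k0).
  rewrite -(@ler_pXn2r _ 2) ?nnegrE ?enorm_ge0// !sqr_enorm opprD addrA.
  rewrite -/y; move: (v - p) @a a0 => x a a0.
  rewrite dotpBl !dotpBr !dotpZr !dotpZl (dotpC y x) -/a -/b => h.
  by rewrite -(ler_pM2l k0); lra.
(* Minimizing over the segment: [k = 1] when [b <= a], else [k = a / b]; either way [2 * a <= a],
   against [0 < a]. *)
have [ba|ab] := leP b a.
  by have := key 1; rewrite ltr01 lexx mul1r => /(_ isT); lra.
have b0 : 0 < b by exact: lt_trans a0 ab.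
have := key (a / b); rewrite divr_gt0//= ler_pdivrMr// mul1r (ltW ab).
by move=> /(_ isT); rewrite divfK ?gt_eqF//; lra.
Qed.

(** Add the two obtuse-angle inequalities and apply Cauchy-Schwarz. *)
Lemma proj_nonexpansive v v' p p' : is_proj W v p -> is_proj W v' p' ->
  enorm (p - p') <= enorm (v - v').
Proof.
move=> vp vp'.
have h1 := proj_obtuse _ _ _ vp vp'.1.
have h2 := proj_obtuse _ _ _ vp' vp.1.
have h : enorm (p - p') ^+ 2 <= enorm (v - v') * enorm (p - p').
  rewrite (le_trans _ (cauchy_schwarz _ _))// sqr_enorm.
  move: h1 h2; rewrite !(dotpBl, dotpBr) (dotpC p' p); lra.
have := enorm_ge0 (p - p'); rewrite le_eqVlt => /predU1P[<-|p0].
  exact: enorm_ge0.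
by rewrite -(ler_pM2r p0) -expr2.
Qed.

(* The comparator moves from [s] to [s'].  If [|p - s'| < |s - s'|], the
   potential is at most [D |s - s'|] outright; otherwise
   [|v - s| >= |v - s'| - |s - s'|] can be squared. *)
Lemma proj_drift v p s s' D : is_proj W v p -> W s' ->
  (forall u u', W u -> W u' -> enorm (u - u') <= D) ->
  enorm (p - s') ^+ 2 <= enorm (v - s) ^+ 2 + 2 * D * enorm (s - s').
Proof.
move=> vp Ws' diamW; have pD : enorm (p - s') <= D := diamW _ _ vp.1 Ws'.
have h := proj_obtuse _ _ _ vp Ws'.
have pv : enorm (p - s') <= enorm (v - s').
  rewrite -(@ler_pXn2r _ 2) ?nnegrE ?enorm_ge0// !sqr_enorm.
  have -> : v - s' = (v - p) + (p - s') by rewrite addrA subrK.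
  rewrite -[s' - p]opprB dotpNr in h.
  move: (v - p) (p - s') h => x y h.
  by rewrite dotpDl !dotpDr (dotpC y x); have := dotp_ge0 x; lra.
have tri := enormD (v - s) (s - s'); rewrite addrA subrK in tri.
move: (enorm_ge0 (p - s')) (enorm_ge0 (s - s')) (enorm_ge0 (v - s)) => p0 s0 v0.
have [ps|sp] := ltP (enorm (p - s')) (enorm (s - s')); first by nra.
have pD2 := ler_wpM2r s0 pD.
have : (enorm (p - s') - enorm (s - s')) ^+ 2 <= enorm (v - s) ^+ 2.
  by rewrite ler_pXn2r ?nnegrE ?subr_ge0//; lra.
rewrite sqrrB; have := sqr_ge0 (enorm (s - s')).
by rewrite -mulrA -mulr_natl; lra.
Qed.

End projection.

(** * Independence of one sample from the sigma-algebra of others *)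

Section independence.
Context d d' (Omega : measurableType d) (E : measurableType d') (R : realType).
Context (Pr : probability Omega R) (I : finType) (X : I -> Omega -> E).
Hypothesis mX : forall i, measurable_fun [set: Omega] (X i).
Hypothesis indX : mutually_independent Pr X.
Variable S : {set I}.

(** A pi-system generating the sigma-algebra of the variables indexed by [S]. *)
Definition cylinders : set (set Omega) :=
  [set C | exists2 A : I -> set E, (forall i, measurable (A i)) &
     C = \bigcap_(i in [set` S]) X i @^-1` A i].

Let mpre i (A : set E) : measurable A -> measurable (X i @^-1` A).
Proof. by move=> mA; rewrite -[X in measurable X]setTI; exact: mX. Qed.

Lemma cylinders_measurable : cylinders `<=` measurable.
Proof.
move=> _ [A mA ->]; apply: fin_bigcap_measurable; first exact: finite_finset.
by move=> i _; exact: mpre.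
Qed.

Lemma setI_closed_cylinders : setI_closed cylinders.
Proof.
move=> _ _ [A mA ->] [B mB ->]; exists (fun i => A i `&` B i).
  by move=> i; exact: measurableI.
by rewrite -bigcapI; apply: eq_bigcapr => i _; rewrite preimage_setI.
Qed.

Lemma cylinders_coord i (A : set E) : i \in S -> measurable A ->
  cylinders (X i @^-1` A).
Proof.
move=> iS mA; exists (fun j => if j == i then A else setT).
  by move=> j; case: ifP.
apply/seteqP; split => [w XA j jS /=|w /(_ i iS)/=]; last by rewrite eqxx.
by case: eqP => // ->.
Qed.

(** As functions of [C], both sides are finite measures. They agree on cylinders by mutual
    independence, hence on the generated sigma-algebra. *)
Lemma cylinders_independent k C (B : set E) : k \notin S ->
  <<s cylinders >> C -> measurable B ->
  Pr (C `&` X k @^-1` B) = (Pr C * Pr (X k @^-1` B))%E.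
Proof.
move=> kS sC mB; have mXB := mpre k B mB.
have fB := fin_num_measure Pr _ mXB.
pose r : {nonneg R} := NngNum (fine_ge0 (measure_ge0 Pr (X k @^-1` B))).
have rE : r%:num%:E = Pr (X k @^-1` B) by rewrite /= fineK.
suff : mrestr Pr mXB C = mscale r Pr C by rewrite /mscale rE muleC.
apply: (g_sigma_algebra_measure_unique cylinders cylinders_measurable
  (fun=> setT)) => //.
- move=> _; exists (fun=> setT) => //.
  by apply/seteqP; split.
- by rewrite bigcup_const//; exists 0%N.
- exact: setI_closed_cylinders.
- move=> _ [A mA ->]; rewrite -[RHS]/(r%:num%:E * Pr _)%E rE -[LHS]/(Pr (_ `&`
  _)).
  (* The product formula is applied to [k |: S] with [B] at [k]; since [k] is not in [S], the other
     factors are unchanged. *)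
  pose A' j := if j == k then B else A j.
  have mA' j : measurable (A' j) by rewrite /A'; case: ifP.
  have := indX (k |: S) A' mA'.
  rewrite big_setU1//= {2}/A' eqxx.
  have -> : (\prod_(i in S) Pr (X i @^-1` A' i) =
             \prod_(i in S) Pr (X i @^-1` A i))%E.
    apply: eq_bigr => i iS; rewrite /A'; case: eqP => // ik.
    by rewrite -ik iS in kS.
  rewrite -(indX S A mA) => <-; congr (Pr _).
  apply/seteqP; split => [w [wA wB] i /=|w /= wA].
    rewrite !inE /A' => /orP[/eqP->|iS]; first by rewrite eqxx.
    by case: eqP => [->//|_]; exact: wA.
  split => [i iS|].
    have := wA i; rewrite /= !inE iS orbT => /(_ isT); rewrite /A'.
    by case: eqP => // ik; move: kS; rewrite -ik iS.
  by have := wA k; rewrite /= !inE eqxx => /(_ isT); rewrite /A' eqxx.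
- by move=> _; rewrite -[X in (X < _)%E]/(Pr (_ `&` _)) setTI ltey_eq fB.
Qed.

End independence.

(** * Fubini for a pair of independent variables *)

Section independent_integral.
Context d d1 d2 (Omega : measurableType d) (F : measurableType d1)
  (E : measurableType d2) (R : realType) (Pr : probability Omega R)
  (P : probability E R) (Y : Omega -> F) (X : Omega -> E).
Hypotheses (mY : measurable_fun [set: Omega] Y)
  (mX : measurable_fun [set: Omega] X).
Hypothesis lawX : forall B, measurable B -> Pr (X @^-1` B) = P B.
Hypothesis indYX : forall A B, measurable A -> measurable B ->
  Pr (Y @^-1` A `&` X @^-1` B) = (Pr (Y @^-1` A) * Pr (X @^-1` B))%E.

(** By independence the law of the pair is the product of the marginal laws; integrating over the
    second variable first gives zero. *)
Lemma independent_Rintegral0 (h : F * E -> R) :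
  measurable_fun [set: F * E] h ->
  Pr.-integrable [set: Omega] (EFin \o (fun w => h (Y w, X w))) ->
  (forall y, \int[P]_x (h (y, x))%:E = 0)%E ->
  \int[Pr]_w h (Y w, X w) = 0.
Proof.
move=> mh Ih h0.
pose phi w := (Y w, X w).
have mphi : measurable_fun [set: Omega] phi by exact: measurable_fun_pair.
pose Y' : {mfun Omega >-> F} := mfun_Sub (mem_set mY).
pose m1 := distribution Pr Y'.
have m12E A : measurable A -> (m1 \x P)%E A = pushforward Pr phi A.
  move=> mA; apply: product_measure_unique => // B C mB mC.
  by rewrite -[X in (_ * X)%E]/(P C) -lawX//; exact: indYX.
have mhE : measurable_fun [set: F * E] (EFin \o h) by exact/measurable_EFinP.
have Iphi := integrable_pushforward mphi mhE Ih measurableT.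
have I12 : (m1 \x P)%E.-integrable [set: F * E] (EFin \o h).
  apply/integrableP; split => //.
  have /integrableP[_] := Iphi; apply: le_lt_trans.
  by rewrite (eq_measure_integral (pushforward Pr phi)) => [//|A mA _];
    exact: m12E.
have : (\int[Pr]_w (EFin \o h) (phi w) = \int[m1 \x P]_z (EFin \o h) z)%E.
  rewrite [RHS](eq_measure_integral (pushforward Pr phi)) => [|A mA _];
    last first.
    exact: m12E.
  by rewrite integral_pushforward.
rewrite /Rintegral -integral12_prod_meas1// => ->.
rewrite (eq_integral (cst 0%E)) ?integral0// => y _; exact: h0.
Qed.

End independent_integral.

(* [Omega] carries no measure: the lemma is applied both to the sigma-algebra of
   the probability space and to the one generated by the past samples. *)
Lemma measurable_online_pgd d (Omega : measurableType d) (R : realType)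
    (n m T : nat) (W : nat -> set 'rV[R]_n) (alpha : R) (w1 : 'rV[R]_n)
    (wstar : nat -> 'rV[R]_n) (x : nat -> 'I_m -> Omega -> 'rV[R]_n)
    (w : nat -> Omega -> 'rV[R]_n) :
  (forall t, (1 <= t <= T)%N -> convex_set (W t)) ->
  online_pgd T W alpha w1
    (fun t omega => glm_stoch_grad (@logistic R) (wstar t)
       (fun i => x t i omega)) w ->
  forall t, (1 <= t <= T)%N ->
    (forall s i, (1 <= s < t)%N -> measurable_fun [set: Omega] (x s i)) ->
    measurable_fun [set: Omega] (w t).
Proof.
move=> cW [w1E wS]; elim=> // t IH /andP[_ tT] mx.
have [->|t0] := posnP t.
  by rewrite (_ : w 1%N = cst w1)//; apply/funext => omega; exact: w1E.
have mxt i : measurable_fun [set: Omega] (x t i) by apply: mx; rewrite t0/=.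
have mwt : measurable_fun [set: Omega] (w t).
  apply: IH; first by rewrite t0 ltnW.
  by move=> s i /andP[s0 st]; apply: mx; rewrite s0/= ltnW.
pose g omega := glm_stoch_grad (@logistic R) (wstar t) (fun i =>
  x t i omega) (w t omega).
have mg : measurable_fun [set: Omega] g.
  apply: measurable_rVZ => //; apply: measurable_rV_sum => i.
  exact: (measurable_sample_grad (wstar t) _ _ (w t) (x t i)).
have mu : measurable_fun [set: Omega] (fun omega =>
  w t omega + (- alpha) *: g omega).
  by apply: measurable_rVD => //; exact: measurable_rVZ.
(* The projection is nonexpansive, so each coordinate of the new iterate is 1-Lipschitz in the
   unprojected point. *)
apply/measurable_rVP => j; apply: (measurable_lipschitz_of _ _ _ _ 1 mu) => a b.
have proj omega : is_proj (W t.+1) (w t omega + (- alpha) *: g omega) (w t.+1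
  omega).
  by rewrite scaleNr; apply: wS; rewrite t0.
have := proj_nonexpansive _ (cW t.+1 tT) _ _ _ _ (proj a) (proj b).
rewrite mul1r; apply: le_trans.
by have := normr_coord_le (w t.+1 a - w t.+1 b) j; rewrite !mxE;
  apply/le_trans/ler_norm.
Qed.

Lemma ae_preimage d d' (Omega : measurableType d) (E : measurableType d')
    (R : realType) (Pr : probability Omega R) (P : probability E R)
    (X : Omega -> E) (Q : E -> Prop) :
  measurable_fun [set: Omega] X ->
  (forall B, measurable B -> Pr (X @^-1` B) = P B) ->
  {ae P, forall x, Q x} -> {ae Pr, forall w, Q (X w)}.
Proof.
move=> mX lawX [N [mN PN0 QN]]; exists (X @^-1` N); split.
- by rewrite -[Y in measurable Y]setTI; exact: mX.
- by rewrite lawX.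
- by move=> w /= nQ; apply: QN.
Qed.

(** * Measurability and independence of the random iterates *)

Section stochastic_gradient.
Context d (Omega : measurableType d) (R : realType) (n m T : nat).
Context (Pr : probability Omega R) (P : probability 'rV[R]_n R).
Hypothesis x_le1 : {ae P, forall x, enorm x <= 1}.
Context (x : nat -> 'I_m -> {RV Pr >-> 'rV[R]_n}).
Hypothesis iid : iid_samples P T x.
Context (W : nat -> set 'rV[R]_n) (wstar : nat -> 'rV[R]_n) (alpha : R).
Context (w1 : 'rV[R]_n) (w : nat -> Omega -> 'rV[R]_n).
Hypothesis W_convex : forall t, (1 <= t <= T)%N -> convex_set (W t).
Let f t := glm_loss P (@logistic R) (wstar t).
Let g t omega :=
  glm_stoch_grad (@logistic R) (wstar t) (fun i => x t i omega).
Let e t omega := g t omega (w t omega) - grad (f t) (w t omega).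
Hypothesis m_gt0 : (0 < m)%N.
Hypothesis W_w1 : W 1%N w1.
Hypothesis pgd : online_pgd T W alpha w1 g w.
Local Notation L1 h := (Pr.-integrable [set: Omega] (EFin \o h)).

Lemma measurable_sample t i : measurable_fun [set: Omega] (x t i).
Proof. exact: measurable_funP. Qed.

Lemma measurable_iterate t : (1 <= t <= T)%N -> measurable_fun [set: Omega] (w
  t).
Proof.
move=> tT; apply: (measurable_online_pgd _ _ _ _ _ _ _ _ _ _ _ _ W_convex pgd _
  tT).
by move=> s i _; exact: measurable_sample.
Qed.

Lemma iterate_mem t omega : (1 <= t <= T)%N -> W t (w t omega).
Proof.
case: t => [//|[|t]] tT; first by rewrite pgd.1.
by have [] := pgd.2 t.+1 omega tT.
Qed.

Lemma ae_sample_le1 t i : (1 <= t <= T)%N ->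
  {ae Pr, forall omega, enorm (x t i omega) <= 1}.
Proof.
move=> tT; apply: ae_preimage x_le1; first exact: measurable_sample.
by move=> B mB; exact: iid.1.
Qed.

(** Ordinals start at 0 and times at 1, hence the successor. *)
Let past t : {set 'I_T * 'I_m} :=
  finset (fun si : 'I_T * 'I_m => (si.1.+1 < t)%N).

Lemma iterate_sample_independent t i A B : (1 <= t <= T)%N ->
  measurable A -> measurable B ->
  Pr (w t @^-1` A `&` x t i @^-1` B) =
  (Pr (w t @^-1` A) * Pr (x t i @^-1` B))%E.
Proof.
move=> tT mA mB.
pose X (si : 'I_T * 'I_m) : Omega -> 'rV[R]_n := x si.1.+1 si.2.
have pT : (t.-1 < T)%N by case: t tT.
pose k : 'I_T * 'I_m := (Ordinal pT, i).
have Xk : X k = x t i by rewrite /X/= prednK//; case/andP: tT.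
have kS : k \notin past t by rewrite inE/= prednK ?ltnn//; case/andP: tT.
have mX si : measurable_fun [set: Omega] (X si) by exact: measurable_sample.
rewrite -Xk; apply: (cylinders_independent _ _ _ _ _ _ _ _ mX iid.2 (past t))
  => //.
(* Here [Omega] carries the sigma-algebra generated by the samples drawn before time [t], for which
   those samples are measurable by construction. *)
have mw : measurable_fun [set: g_sigma_algebraType (cylinders _ _ _ _ _ X (past
  t))]
    (w t : g_sigma_algebraType (cylinders _ _ _ _ _ X (past t)) -> 'rV[R]_n).
  apply: (measurable_online_pgd _ (g_sigma_algebraType (cylinders _ _ _ _ _ X
    (past t)))
    _ _ _ _ _ _ _ _ (fun t i => x t i) _ W_convex pgd _ tT).
  move=> s j /andP[s0 st] _ C mC; rewrite setTI; apply: sub_sigma_algebra.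
  have sT : (s.-1 < T)%N.
    by rewrite prednK//; apply: leq_trans (ltnW st) _; case/andP: tT.
  have -> : (x s j : Omega -> _) = X (Ordinal sT, j) by rewrite /X/= prednK.
  by apply: cylinders_coord => //; rewrite inE/= prednK.
by have := mw measurableT A mA; rewrite setTI.
Qed.

(** * Zero mean of the gradient noise against a function of the current iterate *)

Section unbiased.
Variables (t : nat) (v : 'rV[R]_n -> 'rV[R]_n) (M : R).
Hypothesis tT : (1 <= t <= T)%N.
Hypothesis mv : measurable_fun [set: 'rV[R]_n] v.
Hypothesis vM : forall u, W t u -> enorm (v u) <= M.
Local Notation G := (loss_grad P (wstar t)).

(** The contribution of a single sample to the inner product of the noise with [v]. *)
Let h (z : 'rV[R]_n * 'rV[R]_n) : R :=
  dotp (sample_grad (wstar t) z.1 z.2 - G z.1) (v z.1).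

Let mh : measurable_fun [set: 'rV[R]_n * 'rV[R]_n] h.
Proof.
apply: measurable_dotp; last exact: (measurableT_comp mv).
apply: measurable_rVD.
  by apply: measurable_sample_grad;
    [exact: measurable_fst|exact: measurable_snd].
under eq_fun do rewrite -scaleN1r.
apply: measurable_rVZ => //.
exact: (measurableT_comp (measurable_loss_grad _ x_le1 _)).
Qed.

(** The squared norm is at most 1/8, as the loss is at most 1. With the bound 1/4 on [sample_grad],
    the noise of one sample is almost surely at most 1. *)
Lemma enorm_loss_grad_le1 u : enorm (G u) <= 2^-1.
Proof.
rewrite -(@ler_pXn2r _ 2) ?nnegrE ?enorm_ge0//.
rewrite (le_trans (sqr_enorm_loss_grad _ x_le1 _ _))//.
by have := loss_le1 P (wstar t) u; lra.
Qed.

Let h_ae_bound i : {ae Pr, forall omega, `|h (w t omega, x t i omega)| <= M}.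
Proof.
apply: filterS (ae_sample_le1 t i tT) => omega x1.
rewrite (le_trans (normr_dotp_le _ _))//.
have vw := vM _ (iterate_mem t omega tT).
have M0 : 0 <= M by exact: le_trans (enorm_ge0 _) vw.
rewrite -[leRHS]mul1r ler_pM ?enorm_ge0//.
rewrite (le_trans (enormD _ _))// enormN.
have := enorm_sample_grad (wstar t) (w t omega) (x t i omega).
by have := enorm_loss_grad_le1 (w t omega); rewrite /=; lra.
Qed.

Let mhw i : measurable_fun [set: Omega] (fun omega =>
  h (w t omega, x t i omega)).
Proof.
apply: (measurableT_comp mh); apply: measurable_fun_pair.
  exact: measurable_iterate.
exact: measurable_sample.
Qed.

Let h_L1 i : L1 (fun omega => h (w t omega, x t i omega)).
Proof. exact: (ae_bounded_integrable _ _ _ _ _ M (mhw i) (h_ae_bound i)). Qed.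

Let h_mean i : \int[Pr]_omega h (w t omega, x t i omega) = 0.
Proof.
apply: (independent_Rintegral0 _ _ _ _ _ _ _ Pr P (w t) (x t i)) => //.
- exact: measurable_iterate.
- by move=> B mB; exact: iid.1.
- by move=> A B; exact: iterate_sample_independent.
move=> u.
have msg : measurable_fun [set: 'rV[R]_n] (fun y =>
  dotp (sample_grad (wstar t) u y) (v u)).
  by apply: measurable_dotp => //; exact: measurable_sample_grad.
have I1 : P.-integrable [set: 'rV[R]_n]
    (EFin \o (fun y => dotp (sample_grad (wstar t) u y) (v u))).
  apply: (ae_bounded_integrable _ _ _ _ _ (enorm (v u)) msg).
  apply: filterS x_le1 => y y1; rewrite (le_trans (normr_dotp_le _ _))//.
  rewrite ler_piMl ?enorm_ge0// (le_trans (enorm_sample_grad _ _ _))//.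
  by have := enorm_ge0 y; lra.
have I2 : P.-integrable [set: 'rV[R]_n] (EFin \o (fun=> dotp (G u) (v u))).
  by apply: (bounded_integrable _ _ _ _ _ `|dotp (G u) (v u)|).
have hE y : h (u, y) = dotp (sample_grad (wstar t) u y) (v u) - dotp (G u) (v
  u).
  by rewrite /h dotpBl.
have Ih : P.-integrable [set: 'rV[R]_n] (EFin \o (fun y => h (u, y))).
  by under eq_fun do rewrite hE; exact: integrable_EFinB.
rewrite -[LHS]fineK; last exact: (integrable_fin_num measurableT Ih).
congr EFin; rewrite -[LHS]/(\int[P]_y h (u, y)).
under eq_Rintegral do rewrite hE.
by rewrite RintegralB// Rintegral_cst1 -(dotp_loss_grad _ x_le1) subrr.
Qed.

Let dotp_e omega :
  dotp (e t omega) (v (w t omega)) =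
  m%:R^-1 * \sum_(i < m) h (w t omega, x t i omega).
Proof.
rewrite /e /g /glm_stoch_grad (grad_loss _ x_le1).
(* Writing the exact gradient as an average of [m] copies matches it with the batch, sample by
   sample. *)
have -> : G (w t omega) = m%:R^-1 *: \sum_(i < m) G (w t omega).
  rewrite sumr_const card_ord -[X in _ *: X]scaler_nat scalerA mulVf ?scale1r//.
  by rewrite pnatr_eq0 -lt0n.
rewrite -scalerBr -sumrB dotpZl dotp_suml.
by congr (_ * _).
Qed.

Lemma noise_dotp_L1 : L1 (fun omega => dotp (e t omega) (v (w t omega))).
Proof.
by under eq_fun do rewrite dotp_e; apply: integrable_EFinZ;
  exact: integrable_EFin_sum.
Qed.

Lemma noise_dotp_mean : \int[Pr]_omega dotp (e t omega) (v (w t omega)) = 0.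
Proof.
under eq_Rintegral do rewrite dotp_e.
rewrite RintegralZl//; last exact: integrable_EFin_sum.
by rewrite Rintegral_sum// big1 ?mulr0// => i _; exact: h_mean.
Qed.

End unbiased.

(** * One-step descent of the potential and telescoping *)

Section descent.
Variables (D : R) (delta : nat -> R).
Hypothesis W_diam : forall t, (1 <= t <= T)%N -> is_diam (W t) D.
Hypothesis W_wstar : forall t, (1 <= t <= T)%N -> W t (wstar t).
Hypothesis noise : forall t, (1 <= t <= T)%N ->
  ('E_Pr[fun omega => (enorm (e t omega) ^+ 2)%R] <= (delta t ^+ 2)%R%:E)%E.
Hypothesis alpha_bound : 0 < alpha < 32 * expR (- D).

Let potential t omega := enorm (w t omega - wstar t) ^+ 2.
Let c := 4 * alpha * expR (- D) - alpha ^+ 2 / 8.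

Let measurable_noise t : (1 <= t <= T)%N -> measurable_fun [set: Omega] (e t).
Proof.
move=> tT; apply: measurable_rVD.
  apply: measurable_rVZ => //; apply: measurable_rV_sum => i.
  exact: (measurable_sample_grad (wstar t) _ _ (w t) (x t i)
    (measurable_iterate t tT) (measurable_sample t i)).
under eq_fun do rewrite (grad_loss _ x_le1) -scaleN1r.
apply: measurable_rVZ => //.
apply: (measurableT_comp (measurable_loss_grad _ x_le1 _)).
exact: measurable_iterate.
Qed.

Let noise_L1 t : (1 <= t <= T)%N -> L1 (fun omega => enorm (e t omega) ^+ 2).
Proof.
move=> tT; apply/integrableP; split.
  apply/measurable_EFinP; apply: measurable_funX; apply: measurable_enorm.
  exact: measurable_noise.
(* For a nonnegative integrand the finite bound on the expectation is already integrability. *)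
have := noise t tT; rewrite unlock => h;
  apply: le_lt_trans (ltry (delta t ^+ 2)).
under eq_integral do rewrite /= ger0_norm ?sqr_ge0//.
exact: h.
Qed.

Let noise_mean t : (1 <= t <= T)%N ->
  \int[Pr]_omega (enorm (e t omega) ^+ 2) <= delta t ^+ 2.
Proof.
move=> tT; have := noise t tT; rewrite unlock -lee_fin fineK//.
exact: (integrable_fin_num measurableT (noise_L1 t tT)).
Qed.

Let potential_le t omega : (1 <= t <= T)%N -> enorm (w t omega - wstar t) <= D.
Proof.
by move=> tT; apply: (W_diam t tT).1; [exact: iterate_mem|exact: W_wstar].
Qed.

Let measurable_gap t : (1 <= t <= T)%N ->
  measurable_fun [set: Omega] (fun omega => w t omega - wstar t).
Proof.
by move=> tT; apply: measurable_rVD => //; exact: measurable_iterate.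
Qed.

Let potential_L1 t : (1 <= t <= T)%N -> L1 (potential t).
Proof.
move=> tT; apply: (bounded_integrable _ _ _ _ _ (D ^+ 2)).
  by apply: measurable_funX; apply: measurable_enorm; exact: measurable_gap.
move=> omega; rewrite ger0_norm ?sqr_ge0// lerXn2r ?nnegrE ?enorm_ge0//.
  exact: le_trans (enorm_ge0 _) (potential_le t omega tT).
exact: potential_le.
Qed.

Lemma loss_iterate_L1 t : (1 <= t <= T)%N -> L1 (fun omega => f t (w t omega)).
Proof.
move=> tT; apply: (bounded_integrable _ _ _ _ _ 1).
  apply: (measurableT_comp (measurable_loss _ x_le1 (wstar t))).
  exact: measurable_iterate.
by move=> omega; rewrite ger0_norm ?loss_ge0// loss_le1.
Qed.

Let v t u := (2 * alpha ^+ 2) *: loss_grad P (wstar t) u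
  - (2 * alpha) *: (u - wstar t).

Let descent_pointwise t omega : (1 <= t < T)%N ->
  potential t.+1 omega <= potential t omega - c * f t (w t omega)
    + dotp (e t omega) (v t (w t omega)) + alpha ^+ 2 * enorm (e t omega) ^+ 2
    + 2 * D * enorm (wstar t - wstar t.+1).
Proof.
move=> /andP[t0 tT]; have t1T : (1 <= t.+1 <= T)%N by [].
have tT' : (1 <= t <= T)%N by rewrite t0 ltnW.
have a0 : 0 <= alpha by case/andP : alpha_bound => /ltW.
have proj : is_proj (W t.+1) (w t omega - alpha *: g t omega (w t omega)) (w
  t.+1 omega).
  by apply: pgd.2; rewrite t0.
have := proj_drift _ (W_convex _ t1T) _ _ (wstar t) _ D proj (W_wstar _ t1T)
  (W_diam _ t1T).1.
move=> /le_trans; apply; rewrite lerD2r.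
have -> : g t omega (w t omega) = loss_grad P (wstar t) (w t omega) + e t omega.
  by rewrite /e (grad_loss _ x_le1) addrC subrK.
have hq := loss_quasar _ x_le1 _ _ _ (potential_le t omega tT').
have hs := sqr_enorm_loss_grad _ x_le1 (wstar t) (w t omega).
rewrite addrAC /potential /v !sqr_enorm in hs *.
move: (w t omega - wstar t) hq (e t omega) => y hq ep.
move: (loss_grad P (wstar t) (w t omega)) hq hs => G hq hs.
rewrite -/(f t) in hs hq.
rewrite !(dotpBl, dotpBr, dotpDl, dotpDr, dotpZl, dotpZr, scalerDr).
rewrite (dotpC ep G) (dotpC ep y) (dotpC y G).
(* Quasar-convexity contributes [- 4 * alpha * expR (- D)] times the loss, weak smoothness
   [alpha ^+ 2 / 8] times it; together they make [- c]. *)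
have h1 := ler_wpM2l (mulr_ge0 (ler0n _ 2) a0) hq.
have h2 := ler_wpM2l (sqr_ge0 alpha) hs.
rewrite /c; nra.
Qed.

Lemma descent t : (1 <= t < T)%N ->
  \int[Pr]_omega potential t.+1 omega <=
  \int[Pr]_omega potential t omega - c * \int[Pr]_omega f t (w t omega)
  + alpha ^+ 2 * delta t ^+ 2 + 2 * D * enorm (wstar t - wstar t.+1).
Proof.
move=> tT; have /andP[t0 tT1] := tT; have t1T : (1 <= t.+1 <= T)%N by [].
have tT' : (1 <= t <= T)%N by rewrite t0 ltnW.
have mv : measurable_fun [set: 'rV[R]_n] (v t).
  apply: measurable_rVD.
    by apply: measurable_rVZ => //; exact: measurable_loss_grad.
  under eq_fun do rewrite -scaleN1r.
  by do 2![apply: measurable_rVZ => //]; exact: measurable_rVD.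
(* Boundedness of [v t] on [W t] is what makes the noise term integrable. *)
have vM u : W t u -> enorm (v t u) <= 2 * alpha ^+ 2 + 2 * `|alpha| * D.
  move=> Wu; rewrite (le_trans (enormD _ _))// enormN !enormZ lerD//.
    have a2 : 0 <= 2 * alpha ^+ 2 by rewrite mulr_ge0// sqr_ge0.
    rewrite (ger0_norm a2) ler_piMr//.
    by have := enorm_loss_grad_le1 t u; lra.
  rewrite normrM (ger0_norm (ler0n _ 2)) ler_wpM2l ?mulr_ge0//.
  by apply: (W_diam t tT').1 => //; exact: W_wstar.
have Ip := potential_L1 t tT'.
have If := loss_iterate_L1 t tT'.
have In := noise_L1 t tT'.
have Iz := noise_dotp_L1 t _ _ tT' mv vM.
have z0 := noise_dotp_mean t _ _ tT' mv vM.
have Icf := integrable_EFinZ _ _ _ _ c _ If.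
have Ian := integrable_EFinZ _ _ _ _ (alpha ^+ 2) _ In.
set k := 2 * D * enorm (wstar t - wstar t.+1).
have Ik : L1 (fun=> k) by apply: (bounded_integrable _ _ _ _ _ `|k|).
have I1 := integrable_EFinB _ _ _ _ _ _ Ip Icf.
have I2 := integrable_EFinD _ _ _ _ _ _ I1 Iz.
have I3 := integrable_EFinD _ _ _ _ _ _ I2 Ian.
have I4 := integrable_EFinD _ _ _ _ _ _ I3 Ik.
have := le_Rintegral_setT _ _ _ _ _ _ (potential_L1 _ t1T) I4
  (fun omega => descent_pointwise t omega tT).
rewrite (RintegralD measurableT I3 Ik) (RintegralD measurableT I2 Ian).
rewrite (RintegralD measurableT I1 Iz) (RintegralB measurableT Ip Icf).
rewrite (RintegralZl _ measurableT If) (RintegralZl _ measurableT In).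
rewrite Rintegral_cst1 z0 addr0 => /le_trans; apply.
rewrite lerD2r lerD2l ler_wpM2l ?sqr_ge0//.
exact: noise_mean.
Qed.

(** The potential at [k] stays on the left, to absorb the loss at the final time later. *)
Let telescoped k : (1 <= k <= T)%N ->
  \int[Pr]_omega potential k omega
    + c * \sum_(1 <= t < k) \int[Pr]_omega f t (w t omega) <=
  enorm (w1 - wstar 1%N) ^+ 2
    + 2 * D * \sum_(1 <= t < k) enorm (wstar t - wstar t.+1)
    + alpha ^+ 2 * \sum_(1 <= t < k) delta t ^+ 2.
Proof.
elim: k => // -[_ _|k IH /andP[_ kT]].
  rewrite !big_geq// !mulr0 !addr0 -[leRHS](@Rintegral_cst1 _ _ _ Pr).
  rewrite le_eqVlt; apply/orP; left; apply/eqP; apply: eq_Rintegral => omega _.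
  by rewrite /potential pgd.1.
have := descent k.+1 kT; have := IH (ltnW kT).
by rewrite !(big_nat_recr k.+1)//= !mulrDr; lra.
Qed.

(** [c] factors as [alpha / 8 * (32 * expR (- D) - alpha)]. *)
Let c_gt0 : 0 < c.
Proof. by case/andP: alpha_bound => a0 a32; rewrite /c; nra. Qed.

(* The last loss is absorbed by the last potential: [f <= potential / 32], and
   [c <= 32] because [c] is largest at [alpha = 16 * expR (- D)]. *)
Lemma sum_loss_le : (0 < T)%N ->
  c * \sum_(1 <= t < T.+1) \int[Pr]_omega f t (w t omega) <=
  enorm (w1 - wstar 1%N) ^+ 2
    + 2 * D * \sum_(1 <= t < T) enorm (wstar t - wstar t.+1)
    + alpha ^+ 2 * \sum_(1 <= t < T) delta t ^+ 2.
Proof.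
move=> T0; have TT : (1 <= T <= T)%N by rewrite T0 leqnn.
apply: le_trans (telescoped T TT).
rewrite big_nat_recr//= mulrDr addrC lerD2r.
have fp : \int[Pr]_omega f T (w T omega) <=
          32^-1 * \int[Pr]_omega potential T omega.
  rewrite -RintegralZl//; last exact: potential_L1.
  apply: le_Rintegral_setT; [exact: loss_iterate_L1|apply: integrable_EFinZ;
    exact: potential_L1|].
  by move=> omega; exact: loss_quadratic_growth.
have D0 : 0 <= D by have [_ [u [u' [_ _ <-]]]] := W_diam T TT; exact: enorm_ge0.
have c32 : c <= 32.
  have e1 : expR (- D) <= 1 by rewrite expR_le1 oppr_le0.
  have e0 := expR_gt0 (- D).
  have := sqr_ge0 (alpha - 16 * expR (- D)); rewrite /c; nra.
have p0 : 0 <= \int[Pr]_omega potential T omega.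
  by apply: Rintegral_ge0 => omega _; exact: sqr_ge0.
have := ler_wpM2l (ltW c_gt0) fp; nra.
Qed.

(** Each loss vanishes at its comparator, and bounded losses have finite expectation. *)
Lemma regret_sum_Rintegral :
  regret Pr f wstar w T =
  (\sum_(1 <= t < T.+1) \int[Pr]_omega f t (w t omega))%:E.
Proof.
rewrite /regret -sumEFin; apply: eq_big_nat => t tT.
rewrite (_ : f t (wstar t) = 0) ?sube0; last exact: loss_star.
rewrite unlock -[LHS]fineK//.
exact: (integrable_fin_num measurableT (loss_iterate_L1 t tT)).
Qed.

End descent.
End stochastic_gradient.

(** * Properties of the losses and the regret bound combined *)

Theorem corollary2 (R : realType) (n : nat) (P : probability 'rV[R]_n R)
    (T : nat) (W : nat -> set 'rV[R]_n) (wstar : nat -> 'rV[R]_n) (D : R)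
    (P_abs_cont : P `<< @lebesgue_rV R n)
    (x_le1 : {ae P, forall x, enorm x <= 1})
    (W_closed : forall t, (1 <= t <= T)%N -> closed (W t))
    (W_convex : forall t, (1 <= t <= T)%N -> convex_set (W t))
    (W_diam : forall t, (1 <= t <= T)%N -> is_diam (W t) D)
    (W_wstar : forall t, (1 <= t <= T)%N -> W t (wstar t)) :
  let f t := glm_loss P (@logistic R) (wstar t) in
  (forall t, (1 <= t <= T)%N ->
     [/\ quasar_convex_on (W t) (2 * expR (- D)) (f t) (wstar t),
         weakly_smooth (8^-1) (f t) (wstar t) &
         euclidean_lipschitz (4^-1) (f t)]) /\
  (forall (d : measure_display) (Omega : measurableType d)
      (Pr : probability Omega R) (m : nat)
      (x : nat -> 'I_m -> {RV Pr >-> 'rV[R]_n}) (delta : nat -> R) (alpha : R)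
      (w1 : 'rV[R]_n) (w : nat -> Omega -> 'rV[R]_n),
    let g t omega :=
      glm_stoch_grad (@logistic R) (wstar t) (fun i => x t i omega) in
    let e t omega := g t omega (w t omega) - grad (f t) (w t omega) in
    (0 < m)%N ->
    iid_samples P T x ->
    W 1%N w1 ->
    online_pgd T W alpha w1 g w ->
    (forall t, (1 <= t <= T)%N -> 0 < delta t) ->
    (forall t, (1 <= t <= T)%N ->
       'E_Pr[fun omega => (enorm (e t omega) ^+ 2)%R] <= (delta t ^+ 2)%R%:E)%E ->
    0 < alpha < 32 * expR (- D) ->
    (regret Pr f wstar w T <=
      (8 / (32 * alpha * expR (- D) - alpha ^+ 2) *
         enorm (w1 - wstar 1%N) ^+ 2
       + 24 * D / (32 * alpha * expR (- D) - alpha ^+ 2) *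
         \sum_(1 <= t < T) enorm (wstar t - wstar t.+1)
       + 8 * alpha / (32 * expR (- D) - alpha) *
         \sum_(1 <= t < T) delta t ^+ 2)%R%:E)%E).
Proof.
move=> f; split.
  move=> t tT; split; [split| split |].
  - by rewrite mulr_gt0// expR_gt0.
  - by move=> w; exact: differentiable_loss.
  - exact: is_minimizer_loss.
  (* As the minimum is 0, the inequality reads [rho * f w <= dotp (grad f w) (w - wstar)]. *)
  - move=> w Ww; rewrite /f loss_star (grad_loss _ x_le1) -opprB dotpNr mulrN
    subr_le0.
    rewrite ler_pdivlMl ?mulr_gt0 ?expR_gt0//; apply: loss_quasar => //.
    by apply: (W_diam t tT).1 => //; exact: W_wstar.
  - by move=> w; exact: differentiable_loss.
  - exact: is_minimizer_loss.
  - move=> w; rewrite /f loss_star subr0 (grad_loss _ x_le1).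
    exact: sqr_enorm_loss_grad.
  - exact: loss_lipschitz.
move=> d Omega Pr m x delta alpha w1 w g e m0 iid Ww1 pgd _ noise alphaD.
have /andP[a0 a32] := alphaD.
have b0 : 0 < 32 * expR (- D) - alpha by rewrite subr_gt0.
set k := 32 * alpha * expR (- D) - alpha ^+ 2.
have kE : k = alpha * (32 * expR (- D) - alpha) by rewrite /k; ring.
have k0 : 0 < k by rewrite kE mulr_gt0.
rewrite (regret_sum_Rintegral _ _ _ _ _ _ _ _ x_le1 _ _ _ _ _ _ W_convex pgd)
  lee_fin.
have -> : 8 * alpha / (32 * expR (- D) - alpha) = 8 * alpha ^+ 2 / k.
  by rewrite kE; field; rewrite !gt_eqF.
have [T0|T0] := posnP T.
  (* With no rounds the sums are empty and only the nonnegative first term remains. *)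
  by rewrite T0 !big_geq// !mulr0 !addr0 mulr_ge0 ?divr_ge0 ?sqr_ge0 ?ltW.
have := sum_loss_le _ _ _ _ _ _ _ _ x_le1 _ iid _ _ _ _ _ W_convex m0 Ww1 pgd
  _ _ W_diam W_wstar noise alphaD T0.
(* The descent constant is [k / 8], whence the factors 8 in the bound. *)
have -> : 4 * alpha * expR (- D) - alpha ^+ 2 / 8 = k / 8 by rewrite /k; field.
have D0 : 0 <= D by have [_ [u [u' [_ _ <-]]]] := W_diam 1%N T0;
  exact: enorm_ge0.
have d0 : 0 <= \sum_(1 <= t < T) enorm (wstar t - wstar t.+1).
  by apply: sumr_ge0 => t _; exact: enorm_ge0.
set S1 := \sum_(1 <= t < T.+1) _; set S0 := enorm _ ^+ 2.
set S2 := \sum_(1 <= t < T) enorm _ in d0 *; set S3 := \sum_(1 <= t < T) _ ^+ 2.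
move=> h.
have -> : 8 / k * S0 + 24 * D / k * S2 + 8 * alpha ^+ 2 / k * S3 =
  (8 * S0 + 24 * D * S2 + 8 * alpha ^+ 2 * S3) / k by field; rewrite gt_eqF.
rewrite ler_pdivlMr//.
(* The argument gives [16 * D] in front of the path length; the nonnegative remainder [8 * D * S2]
   is added to reach [24 * D]. *)
have := mulr_ge0 D0 d0; lra.
Qed.
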